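(* For every real $p\ge 2$ there exists a constant $C_p>0$ depending only on $p$ such that the following holds. Let $(\Omega,\mu)$ be a probability space, let $N\ge 1$, let $X,X_1,\ldots,X_N$ be i.i.d. with law $\mu$, and let $\mathcal{F}$ be a nonempty class of real-valued measurable functions on $\Omega$ with $\gamma(\mathcal{F},\psi_2)<\infty$ and $0<d_{\psi_2}(\mathcal{F})<\infty$. Assume that $0\in\mathcal{F}$ or that $\mathcal{F}$ is symmetric (i.e. $f\in\mathcal{F}$ implies $-f\in\mathcal{F}$). Then for every $u\ge 1$, with probability at least $1-\exp\big(-u^2(\gamma(\mathcal{F},\psi_2)/d_{\psi_2}(\mathcal{F}))^2\big)$, $$\sup_{f\in \mathcal{F}} \bigg|\frac{1}{N}\sum_{i=1}^N f^p(X_i) -\mathbb{E} f^p(X)\bigg|\le C_p\bigg( u\, \frac{\gamma(\mathcal{F},\psi_2)\,d^{\,p-1}_{\psi_2}(\mathcal{F})}{\sqrt{N}}+u^p\,\frac{\gamma^p(\mathcal{F},\psi_2)}{N}\bigg).$$ Consequently, $$\mathbb{E} \sup_{f\in \mathcal{F}} \bigg|\frac{1}{N}\sum_{i=1}^N f^p(X_i) -\mathbb{E} f^p(X)\bigg| \le C_p\bigg( \frac{\gamma(\mathcal{F},\psi_2)\,d^{\,p-1}_{\psi_2}(\mathcal{F})}{\sqrt{N}}+\frac{\gamma^{p}(\mathcal{F},\psi_2)}{N}\bigg).$$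
   Context: For a measurable $f:\Omega\to\mathbb{R}$, $\|f\|_{\psi_2}=\inf\{c>0:\mathbb{E}_{X\sim\mu}\exp(|f(X)|^2/c^2)\le 2\}$ (with $\inf\emptyset=\infty$), and $d_{\psi_2}(\mathcal{F})=\sup_{f\in\mathcal{F}}\|f\|_{\psi_2}$. Powers of $\gamma$ and $d$ are written $\gamma^p(\mathcal{F},\psi_2)=(\gamma(\mathcal{F},\psi_2))^p$, etc. Talagrand's functional: for a (pseudo)metric space $(\mathcal{F},d)$, an admissible sequence is an increasing sequence $(\mathcal{F}_s)_{s\ge0}$ of subsets of $\mathcal{F}$ with $\mathcal{F}_s\subset\mathcal{F}_{s+1}$, $|\mathcal{F}_0|=1$, $|\mathcal{F}_s|\le 2^{2^s}$ for $s\ge1$, and $\bigcup_{s\ge 0}\mathcal{F}_s$ dense in $\mathcal{F}$. Then $\gamma(\mathcal{F},d)=\inf\sup_{f\in\mathcal{F}}\sum_{s\ge0}2^{s/2}d(f,\mathcal{F}_s)$, where the infimum is over all admissible sequences and $d(f,\mathcal{F}_s)=\inf_{g\in\mathcal{F}_s}d(f,g)$. $\gamma(\mathcal{F},\psi_2)$ denotes this functional for the distance $d(f,g)=\|f-g\|_{\psi_2}$. Conventions: $f^p(x)=f(x)^p$; when $p$ is not an integer, the functions are understood to be such that this is a well-defined real number (i.e. $f\ge0$). Suprema of families of random variables indexed by $\mathcal{F}$ are understood as lattice (essential) suprema, i.e. the a.s. smallest random variable dominating each member of the family a.s.; for countable $\mathcal{F}$ (or separable processes) this is the pointwise supremum.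 *)

(* Defs.v *)
From HB Require Import structures.
From mathcomp Require Import all_boot all_order all_algebra.
From mathcomp Require Import all_classical all_reals all_analysis.
From mathcomp Require Import measurable_realfun.

Set Implicit Arguments.
Unset Strict Implicit.
Unset Printing Implicit Defensive.

Import Order.TTheory GRing.Theory Num.Theory.
Import numFieldNormedType.Exports.

Local Open Scope classical_set_scope.
Local Open Scope ring_scope.
Local Open Scope ereal_scope.

(* The library's powR is not the signed power at negative bases
   ((-1) `^ r = 1 for all r), hence the separate branch for p in nat. *)
Definition rpower (R : realType) (p x : R) : R :=
  if p \is a Num.nat then (x ^+ Num.truncn p)%R else (x `^ p)%R.

Section psi2.
Context (dO : measure_display) (Omega : measurableType dO) (R : realType).
Variable mu : probability Omega R.

Definition psi2_norm (f : Omega -> R) : \bar R :=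
  ereal_inf [set c%:E | c in [set c : R | (0 < c)%R /\
    \int[mu]_x (expR (`|f x| ^+ 2 / c ^+ 2)%R)%:E <= 2%:E]].

Definition psi2_dist (f g : Omega -> R) : \bar R := psi2_norm (f \- g)%R.

Definition psi2_diam (F : set (Omega -> R)) : \bar R :=
  ereal_sup [set psi2_norm f | f in F].

End psi2.

Section talagrand.
Context (R : realType) (E : Type).
Variable (dist : E -> E -> \bar R) (F : set E).

Definition dist_to_set (f : E) (A : set E) : \bar R :=
  ereal_inf [set dist f g | g in A].

Definition admissible (Fs : nat -> set E) : Prop :=
  [/\ forall s, Fs s `<=` F,
      forall s, Fs s `<=` Fs s.+1,
      (Fs 0%N #= `I_1)%card,
      forall s, (1 <= s)%N -> (Fs s #<= `I_(2 ^ (2 ^ s)))%card &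
      forall f, F f -> forall e : R, (0 < e)%R ->
        exists2 g, (\bigcup_s Fs s) g & dist f g < e%:E].

Definition talagrand_gamma : \bar R :=
  ereal_inf [set ereal_sup
      [set \sum_(0 <= s <oo) ((2 `^ (s%:R / 2))%R%:E * dist_to_set f (Fs s))
        | f in F]
    | Fs in admissible].

End talagrand.

Section random.
Context (dT : measure_display) (T : measurableType dT) (R : realType).
Variable P : probability T R.

Definition mutually_independent (dO : measure_display)
    (Omega : measurableType dO) (N : nat)
    (X : 'I_N -> {mfun T >-> Omega}) : Prop :=
  forall (J : {set 'I_N}) (A : 'I_N -> set Omega),
    (forall i, measurable (A i)) ->
    P (\bigcap_(i in [set` J]) X i @^-1` A i)
      = \prod_(i in J) P (X i @^-1` A i).

Definition iid_with_law (dO : measure_display) (Omega : measurableType dO)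
    (mu : probability Omega R) (N : nat)
    (X : 'I_N -> {mfun T >-> Omega}) : Prop :=
  mutually_independent X /\
  forall i A, measurable A -> distribution P (X i) A = mu A.

Definition dominates (I : Type) (D : set I) (Y : I -> T -> \bar R)
    (Z : T -> \bar R) : Prop :=
  measurable_fun setT Z /\
  forall i, D i -> {ae P, forall w, Y i w <= Z w}.

(* Essential (lattice) supremum; it exists for every family of random
   variables and is unique up to a P-null set. *)
Definition is_lattice_sup (I : Type) (D : set I) (Y : I -> T -> \bar R)
    (Z : T -> \bar R) : Prop :=
  dominates D Y Z /\
  forall W, dominates D Y W -> {ae P, forall w, Z w <= W w}.

End random.

Definition power_deviation (dO dT : measure_display)
    (Omega : measurableType dO) (T : measurableType dT) (R : realType)
    (mu : probability Omega R) (p : R) (N : nat)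
    (X : 'I_N -> {mfun T >-> Omega}) (f : Omega -> R) (w : T) : \bar R :=
  `| (N%:R^-1 * \sum_(i < N) rpower p (f (X i w)))%R%:E
     - 'E_mu[fun x => rpower p (f x)] |.

(* Main.v *)
(* Chaining with truncated increments. Along a chain 0, pi_{s0} f, pi_{s0+1} f,
   ..., f with 2^s0 ~ (gamma/d)^2, put t = u^2 2^s and let (g, h) be two
   consecutive functions with |g - h|_{psi2} <= del. Set
   W = (|g-h|^2/del^2 + g^2/d^2 + h^2/d^2)/3, so that E exp W <= 2, and truncate
   at W <= kappa with kappa = 2 ln^+(N/t). With probability 1 - 5 exp(-24 t),
   - Bernstein's inequality controls the truncated part of g^p - h^p by
     sqrt(N t) del d^(p-1);
   - the sum of W 1_{W > kappa} over the sample is O(t), so Cauchy-Schwarz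
     bounds the remaining part by
     sqrt t del (|g|_q^(q/2) + |h|_q^(q/2)), with q = 2(p-1) and |.|_q the l_q
     norm over the sample.
   The same two bounds for the exponent q itself give a self-bounding inequality
   for M = max_j |f_j|_q, whence M <= C (N^(1/q) d + u gamma); as
   M^(q/2) = M^(p-1), summing over the chain gives the theorem. *)
Require Import Defs.
From HB Require Import structures.
From mathcomp Require Import all_boot all_order all_algebra.
From mathcomp Require Import all_classical all_reals all_analysis.
From mathcomp Require Import measurable_realfun.
From mathcomp Require Import ring lra.

Set Implicit Arguments.
Unset Strict Implicit.
Unset Printing Implicit Defensive.

Import Order.TTheory GRing.Theory Num.Theory.
Import numFieldNormedType.Exports.

Local Open Scope classical_set_scope.
Local Open Scope ring_scope.

(** * Elementary inequalities *)

(** The [p]-th power of a [psi_2] variable has only a [psi_{2/p}] tail, heavier than exponential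
    when [p > 2], so Bernstein's inequality cannot be applied to the increments as they stand.
    Truncation cures this at the price of a random factor, the sample norms of the two functions of
    the link, and the links can be summed only once these norms are bounded along the whole chain.
    The chain starts at 0 and enters the admissible sequence at level [s0], where a union bound is
    affordable with probability [exp(-u^2 (gamma/d)^2)]. The first link costs [u 2^(s0/2) d], which
    is of order [u gamma] only if [d] is at most a multiple of [gamma]; this is where [0 \in F] or
    symmetry enters. Since [F] may be uncountable, the exceptional event must not depend on [f]. It
    is built from all pairs of elements of consecutive finite sets of the admissible sequence; only
    the last link, ending at [f] itself, depends on [f], and it contributes a null set. An estimate
    of this form, almost sure for each [f] outside a common event, is what the minimality of a
    lattice supremum can use. *)

Section RealAnalysis.
Context {R : realType}.
Implicit Types x y z a b r m t : R.

(** Raise [y <= exp y] to the power [m] at [y = a x / m]. The rate [a] is a parameter: [a = 1]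
    bounds moments, [a = 1/2] leaves a factor [exp(-kappa/2)] on a tail, and [a = 1/4] balances a
    square root. *)
Lemma powR_le_expR a m x : 0 < a -> 0 < m -> 0 <= x ->
  x `^ m <= (m / a) `^ m * expR (a * x).
Proof.
move=> a0 m0 x0; have ma0 : 0 <= m / a by rewrite divr_ge0 ?ltW.
have -> : x `^ m = (m / a) `^ m * (a * x / m) `^ m.
  rewrite -powRM ?divr_ge0 ?mulr_ge0 ?(ltW a0) ?(ltW m0)//; congr powR.
  by field; rewrite !gt_eqF.
rewrite ler_wpM2l ?powR_ge0//.
have {2}-> : a * x = a * x / m * m by field; rewrite gt_eqF.
have axm0 : 0 <= a * x / m by rewrite divr_ge0 ?mulr_ge0 ?(ltW m0) ?(ltW a0).
rewrite expRM ge0_ler_powR ?nnegrE ?expR_ge0 ?(ltW m0)//.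
by apply: le_trans (expR_ge1Dx _); rewrite lerDr.
Qed.

(** Two uses of [1 + y <= exp y]: at [-x] it gives [exp x - 1 - x <= x (exp x - 1)], and the last
    factor is then compared with [x], according to the sign of [x]. *)
Lemma expR_le_quadratic x : expR x <= 1 + x + x ^+ 2 * expR `|x|.
Proof.
have e1 : expR x - 1 <= x * expR x.
  have := expR_ge1Dx (- x); rewrite -(ler_pM2r (expR_gt0 x)).
  by rewrite -expRD addNr expR0; lra.
have e2 := expR_ge1Dx x.
have [x0|x0] := leP 0 x; first by rewrite ger0_norm//; nra.
have e3 : 1 <= expR `|x| by rewrite -expR0 ler_expR.
by nra.
Qed.

(** The level is chosen so that [exp(-kappa/2) = min(1, t/n)]. The three conclusions serve, in
    order, the mass of the tail over the sample, the mean of the tail, and the supremum of the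
    truncated function in Bernstein's inequality. *)
Lemma truncation_level t n : 0 < t -> 0 < n -> exists2 kappa : R, 0 <= kappa &
  [/\ expR (- (kappa / 2)) <= t / n, expR (- (kappa / 2)) <= Num.sqrt (t / n) &
    forall m, 0 < m -> Num.sqrt (t / n) * kappa `^ m <= (4 * m) `^ m].
Proof.
move=> t0 n0; have tn0 : 0 < t / n by rewrite divr_gt0.
have [tn|nt] := leP 1 (t / n).
  exists 0 => //; rewrite mul0r oppr0 expR0; split => //.
    by rewrite -sqrtr1 ler_wsqrtr.
  by move=> m m0; rewrite powR0 ?gt_eqF// mulr0 powR_ge0.
have lnN : ln (t / n) < 0 by rewrite ln_lt0// tn0.
exists (- (2 * ln (t / n))); first by nra.
have -> : - (- (2 * ln (t / n)) / 2) = ln (t / n) by field.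
rewrite lnK ?posrE//.
have st : t / n = Num.sqrt (t / n) ^+ 2 by rewrite sqr_sqrtr// ltW.
have s0 : 0 < Num.sqrt (t / n) by rewrite sqrtr_gt0.
have s1 : Num.sqrt (t / n) < 1 by rewrite -sqrtr1 ltr_sqrt.
split => //; first by rewrite {1}st expr2 ger_pMl// ltW.
move=> m m0; set s := Num.sqrt _ in st s0 s1 *.
have k0 : 0 <= - (2 * ln (t / n)) by nra.
(* With [a = 1/4] the exponential is [exp(kappa/4) = 1/s], which cancels the prefactor [s]. *)
apply: (@le_trans _ _ (s * ((m / (4^-1)) `^ m * expR (4^-1 * - (2 * ln (t / n)))))).
  by rewrite ler_wpM2l ?(ltW s0)// powR_le_expR//; lra.
have -> : 4^-1 * - (2 * ln (t / n)) = - ln s.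
  by rewrite st lnXn// -mulr_natl; field.
rewrite expRN lnK ?posrE//.
by rewrite mulrCA divff ?gt_eqF// mulr1 invrK mulrC.
Qed.

Lemma powRB_le r a b : 1 <= r -> 0 <= b -> b <= a ->
  a `^ r - b `^ r <= r * (a - b) * a `^ (r - 1).
Proof.
move=> r1 b0 ba; have a0 : 0 <= a by exact: le_trans ba.
have r0 : 0 < r by exact: lt_le_trans r1.
have [->|rn1] := eqVneq r 1.
  by rewrite !powRr1// subrr powRr0 mulr1 mul1r.
have r1' : 1 < r by rewrite lt_neqAle eq_sym rn1.
(* Young's inequality for the product b * a^(r-1) *)
have := @conjugate_powR R b (a `^ (r - 1)) r (r / (r - 1)) b0 (powR_ge0 _ _) r0.
have r10 : r - 1 != 0 by rewrite subr_eq0.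
have rN0 : r != 0 by rewrite gt_eqF.
have -> : r^-1 + (r / (r - 1))^-1 = 1 by field; rewrite r10.
have -> : 0 < r / (r - 1) by rewrite divr_gt0// subr_gt0.
move=> /(_ erefl erefl).
rewrite -powRrM.
have -> : (r - 1) * (r / (r - 1)) = r by field.
have <- := mulr_powRB1 a0 r0.
set A := a `^ (r - 1); set Br := b `^ r.
have -> : Br / r + a * A / (r / (r - 1)) = (Br + (r - 1) * (a * A)) / r.
  by field; rewrite ?r10 ?rN0.
rewrite ler_pdivlMr// => h; nra.
Qed.

(** The inequality shared by the signed integer power and by [|x|^r]; it allows both to be treated
    at once. *)
Definition power_lipschitz r (phi : R -> R) :=
  forall x y, `|phi x - phi y| <= r * `|x - y| * (`|x| `^ (r - 1) + `|y| `^ (r - 1)).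

Lemma norm_powR_lipschitz r : 1 <= r -> power_lipschitz r (fun x => `|x| `^ r).
Proof.
move=> r1 x y; have r0 : 0 <= r := le_trans ler01 r1.
wlog xy : x y / `|y| <= `|x| => [hw|].
  have [/hw//|/ltW/hw] := leP `|y| `|x|.
  by rewrite distrC [`|y - x|]distrC [_ `^ _ + _]addrC.
rewrite ger0_norm; last first.
  by rewrite subr_ge0 ge0_ler_powR ?nnegrE.
apply: (le_trans (powRB_le r1 (normr_ge0 _) xy)).
rewrite ler_pM//.
- by rewrite mulr_ge0 ?subr_ge0.
- by rewrite ler_wpM2l // lerB_dist.
- by rewrite lerDl powR_ge0.
Qed.

(** Factor out [x - y]: each of the [n+1] remaining monomials is at most [max(|x|,|y|)^n].
    Exchanging [x] and [y] reverses the index of the monomials, hence [rev_ord]. *)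
Lemma exprn_lipschitz n : power_lipschitz n.+1%:R (fun x => x ^+ n.+1).
Proof.
move=> x y; rewrite /= subrXX normrM [_%:R * _]mulrC -mulrA ler_wpM2l//.
apply: (le_trans (ler_norm_sum _ _ _)).
have nE : n.+1%:R - 1 = n%:R :> R by rewrite -natr1 addrK.
rewrite nE !powR_mulrn//.
rewrite mulr_natl -[X in _ *+ X]card_ord -sumr_const.
apply: ler_sum => i _; rewrite normrM !normrX.
wlog xy : x y i / `|y| <= `|x| => [hw|].
  have [/hw//|/ltW/hw] := leP `|y| `|x|.
  move=> /(_ (rev_ord i)) /=; rewrite [in X in X -> _]addrC mulrC subSS.
  by rewrite subKn// -ltnS.
apply: (@le_trans _ _ (`|x| ^+ n)); last by rewrite lerDl exprn_ge0.
have -> : `|x| ^+ n = `|x| ^+ (n - i) * `|x| ^+ i.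
  by rewrite -exprD subnK// -ltnS.
by rewrite ler_wpM2l ?exprn_ge0// lerXn2r ?nnegrE.
Qed.

End RealAnalysis.

(** * Independence *)

Section Independence.
Context {R : realType} {dO dT : measure_display}.
Context {Omega : measurableType dO} {T : measurableType dT}.
Variables (mu : probability Omega R) (P : probability T R).

Import HBNNSimple.

(** The hypothesis is the factorisation for indicators; it extends to simple functions by linearity
    and to [f] by monotone convergence. [G] is meant to be the product of the factors at the other
    coordinates and [c] its integral. *)
Lemma ge0_integral_weighted (X : {mfun T >-> Omega}) (G : T -> R) (c : R) :
  measurable_fun setT G -> (forall w, 0 <= G w) -> 0 <= c ->
  (forall A, measurable A ->
    (\int[P]_w (\1_A (X w) * G w)%:E = mu A * c%:E)%E) ->
  forall f : Omega -> R, measurable_fun setT f -> (forall x, 0 <= f x) ->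
  (\int[P]_w (f (X w) * G w)%:E = (\int[mu]_x (f x)%:E) * c%:E)%E.
Proof.
move=> mG G0 c0 XG f mf f0.
have mEf : measurable_fun setT (EFin \o f) by exact/measurable_EFinP.
have f0' x : setT x -> (0 <= (EFin \o f) x)%E by move=> _; rewrite lee_fin.
pose f_ := nnsfun_approx measurableT mEf.
have cvgf x : EFin \o f_ ^~ x @ \oo --> (f x)%:E.
  exact: (cvg_nnsfun_approx _ mEf f0').
have ndf : nondecreasing_seq (f_ : (Omega -> R)^nat).
  exact: nd_nnsfun_approx.
have mfX n : measurable_fun setT (fun w => f_ n (X w)).
  exact: (measurableT_comp (measurable_funPT (f_ n)) (measurable_funPT X)).
have mA n y : measurable (f_ n @^-1` [set y]).
  by rewrite -[X in measurable X]setTI; apply: (measurable_funPT (f_ n)).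
have m1X A : measurable A -> measurable_fun setT (fun w => \1_A (X w) : R).
  move=> mA'; apply: (@measurableT_comp _ _ _ _ _ _ (\1_A : Omega -> R)) => //.
have e1 n : (\int[P]_w (f_ n (X w) * G w)%:E =
    (\int[mu]_x (f_ n x)%:E) * c%:E)%E.
  transitivity (\sum_(y \in range (f_ n))
      \int[P]_w ((y * (\1_(f_ n @^-1` [set y]) (X w) * G w))%:E))%E.
    rewrite -ge0_integral_fsum//; last 2 first.
    - move=> y; apply/measurable_EFinP; apply: measurable_funM => //.
      by apply: measurable_funM => //; exact: m1X.
    - move=> y w _; rewrite lee_fin.
      have [y0|y0] := leP 0 y; first by rewrite !mulr_ge0.
      by rewrite preimage_nnfun0//= indicE memNset// mul0r mulr0.
    apply: eq_integral => w _.
    rewrite fimfunE fsumEFin//.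
    rewrite fsbig_finite//= [in RHS]fsbig_finite//= mulr_suml.
    by congr EFin; apply: eq_bigr => y _; rewrite mulrA.
  rewrite integralT_nnsfun sintegralE.
  rewrite fsbig_finite//= [in RHS]fsbig_finite//=.
  rewrite ge0_sume_distrl; last first.
    move=> y _; have [y0|y0] := leP 0 y; first by rewrite mule_ge0.
    by rewrite preimage_nnfun0// measure0 mule0.
  apply: eq_bigr => y _.
  have [y0|y0] := leP 0 y; last first.
    rewrite preimage_nnfun0// measure0 mule0 mul0e.
    by apply: integral0_eq => w _; rewrite indicE memNset// mul0r mulr0.
  under eq_integral do rewrite EFinM.
  rewrite ge0_integralZl_EFin//; last 2 first.
  - by move=> w _; rewrite lee_fin mulr_ge0.
  - by apply/measurable_EFinP; apply: measurable_funM => //; exact: m1X.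
  by rewrite XG// muleA.
have lhs : (\int[P]_w (f_ n (X w) * G w)%:E)%E @[n --> \oo] -->
    (\int[P]_w (f (X w) * G w)%:E)%E.
  have -> : (\int[P]_w (f (X w) * G w)%:E =
      \int[P]_w limn (fun n => (f_ n (X w) * G w)%:E))%E.
    apply: eq_integral => w _; apply/esym/cvg_lim => //.
    under eq_fun do rewrite EFinM muleC.
    by rewrite EFinM muleC; apply: cvgeZl => //; exact: cvgf.
  apply: cvg_monotone_convergence => //.
  - by move=> n; apply/measurable_EFinP; exact: measurable_funM.
  - by move=> n w _; rewrite lee_fin mulr_ge0.
  - by move=> w _ m n mn; rewrite lee_fin ler_wpM2r//; exact/lefP/ndf.
have rhs : ((\int[mu]_x (f_ n x)%:E) * c%:E)%E @[n --> \oo] -->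
    ((\int[mu]_x (f x)%:E) * c%:E)%E.
  under eq_fun do rewrite muleC; rewrite muleC; apply: cvgeZl => //.
  have -> : (\int[mu]_x (f x)%:E = \int[mu]_x limn (fun n => (f_ n x)%:E))%E.
    by apply: eq_integral => x _; apply/esym/cvg_lim => //; exact: cvgf.
  apply: cvg_monotone_convergence => //.
  - by move=> n; apply/measurable_EFinP; exact: measurable_funPT.
  - by move=> n w _; rewrite lee_fin.
  - by move=> w _ m n mn; rewrite lee_fin; exact/lefP/ndf.
rewrite -(cvg_lim _ rhs)// -(cvg_lim _ lhs)//.
by congr (limn _); apply/funext => n; exact: e1.
Qed.

(** Independence is known for events only. Indicators are exchanged for the functions [f i] one
    coordinate at a time: without any exchange the claim is independence, and each exchange is
    [ge0_integral_weighted]. The sets [A] stay universally quantified because the exchange needs the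
    previous case for every set at the new coordinate. *)
Lemma indep_prod_integral (N : nat) (X : 'I_N -> {mfun T >-> Omega})
    (f : 'I_N -> Omega -> R) :
  iid_with_law P mu X ->
  (forall i, measurable_fun setT (f i)) -> (forall i x, 0 <= f i x) ->
  (forall i, (\int[mu]_x (f i x)%:E < +oo)%E) ->
  (\int[P]_w (\prod_i f i (X i w))%:E = \prod_i \int[mu]_x (f i x)%:E)%E.
Proof.
move=> [indX lawX] mf f0 fy.
suff H (k : nat) : (k <= N)%N -> forall A : 'I_N -> set Omega,
    (forall i, measurable (A i)) ->
    let h (i : 'I_N) := if (i < k)%N then f i else \1_(A i) in
    (\int[P]_w (\prod_i h i (X i w))%:E = \prod_i \int[mu]_x (h i x)%:E)%E.
  have := H N (leqnn N) (fun=> setT) (fun=> measurableT).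
  rewrite /=; under eq_integral do under eq_bigr do rewrite ltn_ord.
  by under eq_bigr do rewrite ltn_ord.
elim: k => [_ A mA /=|k IH kN A mA h].
  transitivity (P (\bigcap_(i in [set: 'I_N]) X i @^-1` A i)).
    transitivity (\int[P]_w (\1_(\bigcap_(i in [set: 'I_N]) X i @^-1` A i) w)%:E)%E; last first.
      rewrite integral_indic// ?setIT//.
      apply: fin_bigcap_measurable; first exact: finite_finset.
      move=> i _; rewrite -[X in measurable X]setTI.
      exact: (measurable_funPT (X i)).
    apply: eq_integral => w _; congr EFin.
    have [wA|] := pselect ((\bigcap_(i in [set: 'I_N]) X i @^-1` A i) w).
      rewrite indicE mem_set// big1// => i _.
      by rewrite indicE mem_set//; apply: wA.
    move=> wA; rewrite indicE memNset//.
    have /existsNP[i /not_implyP[_ wi]] := wA.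
    by rewrite (bigD1 i)//= indicE memNset// mul0r.
  have := indX [set: 'I_N]%SET A mA.
  have -> : \bigcap_(i in [set` [set: 'I_N]%SET]) X i @^-1` A i =
            \bigcap_(i in [set: 'I_N]) X i @^-1` A i.
    by apply: eq_bigcapl; split => // i _ /=; rewrite inE.
  move=> ->; rewrite big_mkcond/=; apply: eq_bigr => i _.
  by rewrite inE integral_indic// setIT; exact: lawX.
pose k' := Ordinal kN.
pose G w := \prod_(i | i != k') h i (X i w).
have mhX i : measurable_fun setT (fun w => h i (X i w)).
  apply: (@measurableT_comp _ _ _ _ _ _ (h i)) => //.
  by rewrite /h; case: ifP => // _; exact: measurable_indic.
have h0 (i : 'I_N) x : 0 <= h i x.
  by rewrite /h; case: (i < k.+1)%N; [exact: f0|rewrite indicE].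
have mG : measurable_fun setT G.
  rewrite (_ : G = fun w => \prod_i if i != k' then h i (X i w) else 1).
    by apply: measurable_prod => i _; case: (i != k').
  by apply/funext => w; rewrite /G [LHS]big_mkcond.
have G0 w : 0 <= G w by apply: prodr_ge0 => i _; exact: h0.
have hfin i : (\int[mu]_x (h i x)%:E \is a fin_num)%E.
  rewrite ge0_fin_numE; last by apply: integral_ge0 => x _; rewrite lee_fin.
  rewrite /h; case: ifP => // _; rewrite integral_indic// setIT.
  by rewrite (le_lt_trans (probability_le1 _ _))// ltry.
pose c : \bar R := (\prod_(i | i != k') \int[mu]_x (h i x)%:E)%E.
have cE : c = (fine c)%:E by rewrite fineK//; exact: prode_fin_num.
have c0 : (0 <= c)%E.
  by apply: prode_ge0 => i _; apply: integral_ge0 => x _; rewrite lee_fin.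
rewrite (bigD1 k')//= -/c cE.
under eq_integral do rewrite (bigD1 k')//= -/(G _).
have hk : h k' = f k' by rewrite /h /= ltnSn.
rewrite hk; apply: ge0_integral_weighted => //; first exact: fine_ge0.
(* The indicator case at coordinate [k] is the induction hypothesis with [B] as the [k]-th set. *)
move=> B mB; pose A' (i : 'I_N) := if i == k' then B else A i.
have mA' i : measurable (A' i) by rewrite /A'; case: ifP.
have := IH (ltnW kN) A' mA'; rewrite /= (bigD1 k')//=.
have h'E i : i != k' -> (if (i < k)%N then f i else \1_(A' i)) = h i.
  move=> ik; rewrite /h /A' (negbTE ik) ltnS [(i <= k)%N]leq_eqVlt.
  by rewrite (_ : (i == k :> nat) = false)//; apply: contraNF ik => /eqP ?; apply/eqP/val_inj.
rewrite ltnn {2}/A' eqxx integral_indic// setIT.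
have -> : (\prod_(i | i != k') \int[mu]_x
    ((if (i < k)%N then f i else \1_(A' i)) x)%:E = c)%E.
  by apply: eq_bigr => i ik; rewrite h'E.
rewrite -cE => <-; apply: eq_integral => w _; congr EFin.
rewrite [RHS](bigD1 k')//= ltnn /A' eqxx; congr *%R.
by apply: eq_bigr => i ik; rewrite -/(A' i) h'E.
Qed.
End Independence.

(** * Exponential tail bounds *)

Lemma measurable_set_le {d} {T : measurableType d} {R : realType} (f g : T -> R) :
  measurable_fun setT f -> measurable_fun setT g ->
  measurable [set x | f x <= g x].
Proof.
move=> mf mg; rewrite -[X in measurable X]setTI.
exact: measurable_fun_le.
Qed.

Section Concentration.
Context {R : realType} {dO dT : measure_display}.
Context {Omega : measurableType dO} {T : measurableType dT}.
Variables (mu : probability Omega R) (P : probability T R).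

Lemma chernoff (N : nat) (X : 'I_N -> {mfun T >-> Omega}) (h : Omega -> R)
    (a b : R) :
  iid_with_law P mu X -> measurable_fun setT h ->
  (\int[mu]_x (expR (h x))%:E <= (expR b)%:E)%E ->
  (P [set w | (a <= \sum_i h (X i w))%R] <= (expR (N%:R * b - a))%:E)%E.
Proof.
move=> iidX mh hb.
have mhX i : measurable_fun setT (fun w => h (X i w)).
  exact: measurableT_comp.
have mS : measurable_fun setT (fun w => \sum_i h (X i w)) by exact: measurable_sum.
have mA : measurable [set w | a <= \sum_i h (X i w)].
  exact: measurable_set_le (measurable_cst a) mS.
rewrite -[in leLHS](setIT [set w | _]) -integral_indic//.
apply: (@le_trans _ _ (\int[P]_w ((expR (- a))%:E * (\prod_i expR (h (X i w)))%:E))%E).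
  apply: ge0_le_integral => //.
  - by apply/measurable_EFinP; exact: measurable_indic.
  - apply/measurable_EFinP; apply: measurable_funM => //.
    apply: measurable_prod => i _; exact: measurableT_comp.
  - move=> w _; rewrite -EFinM lee_fin -expR_sum -expRD indicE.
    have [wA|wA] := boolP (w \in _); last exact: expR_ge0.
    rewrite -[leLHS]expR0 ler_expR.
    by move: wA; rewrite inE /= => wA; rewrite addrC subr_ge0.
rewrite ge0_integralZl_EFin ?expR_ge0//; last 2 first.
- by move=> w _; rewrite lee_fin; apply: prodr_ge0 => i _; exact: expR_ge0.
- apply/measurable_EFinP; apply: measurable_prod => i _; exact: measurableT_comp.
have mexp : measurable_fun setT (fun x => expR (h x)) by exact: measurableT_comp.
rewrite (indep_prod_integral iidX (f := fun _ x => expR (h x)))//; last first.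
  by move=> i; rewrite (le_lt_trans hb)// ltry.
apply: (@le_trans _ _ ((expR (- a))%:E * \prod_(i < N) (expR b)%:E)%E).
  rewrite lee_pmul2l ?lte_fin ?expR_gt0//.
  have I0 : (0 <= \int[mu]_x (expR (h x))%:E)%E.
    by apply: integral_ge0 => x _; rewrite lee_fin expR_ge0.
  elim: (N) => [|n IHn]; first by rewrite !big_ord0.
  rewrite !big_ord_recl; apply: lee_pmul => //.
  by apply: prode_ge0.
rewrite prodEFin -EFinM lee_fin prodr_const card_ord -expRM_natl -expRD.
by rewrite addrC.
Qed.

Lemma integral_probability_cst (c : R) : (\int[mu]_x c%:E = c%:E)%E.
Proof.
by rewrite [LHS](integral_cst mu measurableT c%:E) [X in (_ * X)%E]probability_setT mule1.
Qed.

Lemma le_integral_fin (f g : Omega -> R) (c : R) :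
  measurable_fun setT f -> measurable_fun setT g -> (forall x, 0 <= f x) ->
  (forall x, f x <= g x) -> (\int[mu]_x (g x)%:E <= c%:E)%E ->
  (\int[mu]_x (f x)%:E <= c%:E)%E.
Proof.
move=> mf mg f0 fg; apply: le_trans.
apply: ge0_le_integral => //; try exact/measurable_EFinP.
- by move=> x _; rewrite lee_fin.
- by move=> x _; rewrite lee_fin.
Qed.

Lemma integrable_dominated (f g : Omega -> R) (c : R) :
  measurable_fun setT f -> measurable_fun setT g -> 
  (forall x, `|f x| <= g x) -> (\int[mu]_x (g x)%:E <= c%:E)%E ->
  mu.-integrable setT (EFin \o f).
Proof.
move=> mf mg fg gc; apply/integrableP; split; first exact/measurable_EFinP.
apply: (@le_lt_trans _ _ c%:E); last exact: ltry.
by apply: (le_integral_fin _ mg) => //; exact: measurableT_comp.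
Qed.

Lemma le_norm_Rintegral_dominated (f g : Omega -> R) (c : R) :
  measurable_fun setT f -> measurable_fun setT g -> 
  (forall x, `|f x| <= g x) -> (\int[mu]_x (g x)%:E <= c%:E)%E ->
  `|\int[mu]_x f x| <= c.
Proof.
move=> mf mg fg gc; have fi := integrable_dominated mf mg fg gc.
rewrite -lee_fin; apply: (@le_trans _ _ (\int[mu]_x `|f x|%:E)%E).
  rewrite EFin_normr_Rintegral//; apply: le_abse_integral => //.
  exact/measurable_EFinP.
by apply: (le_integral_fin _ mg) => //; exact: measurableT_comp.
Qed.

(** Integrate [expR_le_quadratic], then use [1 + y <= exp y]. The bound [v] is on the second moment,
    not on the variance; [exp B] is the price of the quadratic remainder and stays a constant as
    long as [|l| b] does. *)
Lemma mgf_bounded (Y : Omega -> R) (b v l B : R) :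
  measurable_fun setT Y -> (forall x, `|Y x| <= b) ->
  (\int[mu]_x (Y x ^+ 2)%:E <= v%:E)%E -> `|l| * b <= B ->
  (\int[mu]_x (expR (l * Y x))%:E <=
    (expR (l * (\int[mu]_x Y x) + l ^+ 2 * v * expR B))%:E)%E.
Proof.
move=> mY Yb Yv lbB.
have mY2 : measurable_fun setT (fun x => Y x ^+ 2) by exact: measurable_funX.
have iY : mu.-integrable setT (EFin \o Y).
  apply: (@integrable_dominated _ (cst b) b) => //.
  by rewrite integral_probability_cst.
have iY2 : mu.-integrable setT (EFin \o (fun x => Y x ^+ 2)).
  apply: (@integrable_dominated _ (fun x => Y x ^+ 2) v) => // x.
  by rewrite ger0_norm// sqr_ge0.
pose k := l ^+ 2 * expR B.
have k0 : 0 <= k by rewrite mulr_ge0 ?sqr_ge0 ?expR_ge0.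
apply: (@le_trans _ _ (\int[mu]_x (1 + l * Y x + k * (Y x ^+ 2))%:E)%E).
  have mr : measurable_fun setT (fun x => 1 + l * Y x + k * Y x ^+ 2).
    apply: measurable_funD; last exact: measurable_funM.
    by apply: measurable_funD => //; exact: measurable_funM.
  have er x : expR (l * Y x) <= 1 + l * Y x + k * Y x ^+ 2.
    apply: (le_trans (expR_le_quadratic _)); rewrite lerD2l exprMn /k.
    rewrite [leRHS]mulrAC; apply: ler_wpM2l.
      by rewrite mulr_ge0// sqr_ge0.
    rewrite ler_expR normrM.
    by rewrite (le_trans _ lbB)// ler_wpM2l.
  apply: ge0_le_integral => //.
  - by apply/measurable_EFinP; apply: measurableT_comp => //; exact: measurable_funM.
  - exact/measurable_EFinP.
  - by move=> x _; rewrite lee_fin.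
have -> : (\int[mu]_x (1 + l * Y x + k * (Y x ^+ 2))%:E =
   (1 + l * (\int[mu]_x Y x) + k * (\int[mu]_x (Y x ^+ 2)))%:E)%E.
  under eq_integral do rewrite !EFinD !EFinM.
  have i1 : mu.-integrable setT (fun x => l%:E * (Y x)%:E)%E by exact: integrableZl.
  have i2 : mu.-integrable setT (fun x => k%:E * (Y x ^+ 2)%:E)%E by exact: integrableZl.
  have i0 : mu.-integrable setT (fun x => 1%:E : \bar R).
    by apply: finite_measure_integrable_cst.
  rewrite integralD//; last exact: integrableD.
  rewrite integralD// integral_probability_cst.
  rewrite !integralZl//.
  rewrite !EFinD !EFinM /Rintegral !fineK//; exact: integrable_fin_num.
rewrite lee_fin; apply: (le_trans _ (expR_ge1Dx _)).
rewrite addrA lerD2l /k mulrAC ler_wpM2r ?expR_ge0// ler_wpM2l ?sqr_ge0//.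
rewrite -lee_fin /Rintegral fineK//; exact: integrable_fin_num.
Qed.

(** The Chernoff bound at [l] and at [-l], which share [l^2] and [B]. The parameter [l] is left
    free, and multiplying the event by [l] keeps the statement meaningful at [l = 0]. *)
Lemma bernstein (N : nat) (X : 'I_N -> {mfun T >-> Omega}) (Y : Omega -> R)
    (b v l B x : R) :
  iid_with_law P mu X -> measurable_fun setT Y -> (forall x, `|Y x| <= b) ->
  (\int[mu]_x (Y x ^+ 2)%:E <= v%:E)%E -> 0 <= l -> l * b <= B ->
  (P [set w | (l * x <= l * `|\sum_i Y (X i w) - N%:R * \int[mu]_x Y x|)%R] <=
    (2 * expR (N%:R * (l ^+ 2 * v * expR B) - l * x))%:E)%E.
Proof.
move=> iidX mY Yb Yv l0 lbB.
set EY := Rintegral _ _ _.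
have mlY k : measurable_fun setT (fun x => k * Y x) by exact: measurable_funM.
have mS k : measurable_fun setT (fun w => \sum_i k * Y (X i w)).
  by apply: measurable_sum => i; exact: measurableT_comp (mlY k) _.
have tail k : `|k| = l ->
    (P [set w | (l * x + N%:R * (k * EY) <= \sum_i k * Y (X i w))%R] <=
    (expR (N%:R * (l ^+ 2 * v * expR B) - l * x))%:E)%E.
  move=> kl.
  have kbB : `|k| * b <= B by rewrite kl.
  have := chernoff (l * x + N%:R * (k * EY)) iidX (mlY k) (mgf_bounded mY Yb Yv kbB).
  have -> : k ^+ 2 = l ^+ 2 by rewrite -kl real_normK// num_real.
  move/le_trans; apply; rewrite lee_fin ler_expR -/EY.
  by rewrite mulrDr; lra.
have mA k : measurable [set w | (l * x + N%:R * (k * EY) <= \sum_i k * Y (X i w))%R].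
  exact: measurable_set_le (measurable_cst _) (mS k).
apply: (@le_trans _ _ (P ([set w | (l * x + N%:R * (l * EY) <= \sum_i l * Y (X i w))%R] `|`
    [set w | (l * x + N%:R * (- l * EY) <= \sum_i (- l) * Y (X i w))%R]))).
  apply: le_measure; rewrite ?inE//; last 2 first.
  - exact: measurableU.
  - move=> w /=; rewrite -!mulr_sumr.
    have [h|h] := leP 0 (\sum_i Y (X i w) - N%:R * EY).
      by rewrite ger0_norm//; left; nra.
    by rewrite ltr0_norm//; right; nra.
  apply: measurable_set_le (measurable_cst _) _ => //.
  apply: measurable_funM => //; apply: measurableT_comp => //.
  apply: measurable_funB => //; apply: measurable_sum => i.
  exact: measurableT_comp.
apply: (le_trans (measureU2 _ _ _)); rewrite ?mA//.
set e := expR _ in tail *.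
rewrite [2 * e]mulr_natl [e *+ 2]mulr2n EFinD; apply: leeD; apply: tail.
- by rewrite ger0_norm.
- by rewrite normrN ger0_norm.
Qed.

End Concentration.

(** * Truncated sums *)

Section TruncatedSums.
Context {R : realType} {dO dT : measure_display}.
Context {Omega : measurableType dO} {T : measurableType dT}.
Variables (mu : probability Omega R) (P : probability T R).
Variables (N : nat) (X : 'I_N -> {mfun T >-> Omega}) (W : Omega -> R) (t kappa : R).
Hypotheses (N0 : (0 < N)%N) (iidX : iid_with_law P mu X) (t0 : 0 < t).
Hypotheses (mW : measurable_fun setT W) (W0 : forall x, 0 <= W x).
Hypothesis intW : (\int[mu]_x (expR (W x))%:E <= 2%:E)%E.
Hypothesis kappa0 : 0 <= kappa.
Hypothesis kappa_t : expR (- (kappa / 2)) <= t / N%:R.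
Hypothesis kappa_sqrt : expR (- (kappa / 2)) <= Num.sqrt (t / N%:R).
Hypothesis kappa_powR : forall m, 0 < m ->
  Num.sqrt (t / N%:R) * kappa `^ m <= (4 * m) `^ m.

Let NR0 : 0 < N%:R :> R. Proof. by rewrite ltr0n. Qed.

Let mtrunc : measurable_fun setT (fun x => W x <= kappa).
Proof. exact: measurable_fun_ler. Qed.

Let mexpW : measurable_fun setT (fun x => expR (W x)).
Proof. exact: measurableT_comp. Qed.

Let mcexpW c : measurable_fun setT (fun x => c * expR (W x)).
Proof. exact: measurable_funM. Qed.

Let intcW c : 0 <= c -> (\int[mu]_x (c * expR (W x))%:E <= (c * 2)%:E)%E.
Proof.
move=> c0; under eq_integral do rewrite EFinM.
rewrite ge0_integralZl_EFin//.
- by rewrite EFinM lee_wpmul2l ?lee_fin.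
- exact/measurable_EFinP.
Qed.

(* (2m)^(2m) * 2 bounds the second moment of the truncated function, and (4m)^m
   its supremum times sqrt (t / N). *)
Definition bernstein_const (m K : R) : R :=
  K + (2 * m) `^ (2 * m) * 2 * expR ((4 * m) `^ m).

Lemma truncated_bernstein (m K : R) (D : Omega -> R) : 0 < m ->
  measurable_fun setT D -> (forall x, `|D x| <= W x `^ m) ->
  (P [set w | (bernstein_const m K * Num.sqrt (N%:R * t) <=
      `|\sum_i (if W (X i w) <= kappa then D (X i w) else 0) -
        N%:R * \int[mu]_x (if W x <= kappa then D x else 0)|)%R] <=
    (2 * expR (- (K * t)))%:E)%E.
Proof.
move=> m0 mD DW; pose Y x := if W x <= kappa then D x else 0.
have mY : measurable_fun setT Y by exact: measurable_fun_ifT.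
(* For this [l] both [N l^2] and [l sqrt(N t)] equal [t], so the exponent is a multiple of [t], and
   [kappa_powR] bounds [l] times the supremum of the truncated function by [(4m)^m]. *)
set l := Num.sqrt (t / N%:R).
have l0 : 0 < l by rewrite sqrtr_gt0 divr_gt0.
have l2 : N%:R * l ^+ 2 = t.
  by rewrite sqr_sqrtr ?divr_ge0 ?ltW// mulrC divfK// gt_eqF.
have lt : l * Num.sqrt (N%:R * t) = t.
  rewrite -sqrtrM ?divr_ge0 ?ltW//.
  have -> : t / N%:R * (N%:R * t) = t ^+ 2 by field; rewrite gt_eqF.
  by rewrite sqrtr_sqr gtr0_norm.
have m20 : 0 < 2 * m by rewrite mulr_gt0.
have Yb x : `|Y x| <= kappa `^ m.
  rewrite /Y; case: (leP (W x) kappa) => [Wk|_]; last by rewrite normr0 powR_ge0.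
  by rewrite (le_trans (DW x))// ge0_ler_powR ?nnegrE// ltW.
have Yv : (\int[mu]_x (Y x ^+ 2)%:E <= ((2 * m) `^ (2 * m) * 2)%:E)%E.
  apply: (le_integral_fin _ (mcexpW _) _ _ (intcW (powR_ge0 _ _))).
  - exact: measurable_funX.
  - by move=> x; exact: sqr_ge0.
  move=> x; have := powR_le_expR ltr01 m20 (W0 x).
  rewrite divr1 mul1r; apply: le_trans.
  rewrite mulrC powRrM powR_mulrn ?powR_ge0// -[Y x ^+ 2]real_normK ?num_real//.
  rewrite lerXn2r ?nnegrE ?powR_ge0// /Y; case: ifP => // _.
  by rewrite normr0 powR_ge0.
have := bernstein (bernstein_const m K * Num.sqrt (N%:R * t)) iidX mY Yb Yv
  (ltW l0) (kappa_powR m0).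
have <- : [set w | (bernstein_const m K * Num.sqrt (N%:R * t) <=
      `|\sum_i Y (X i w) - N%:R * \int[mu]_x Y x|)%R] =
  [set w | (l * (bernstein_const m K * Num.sqrt (N%:R * t)) <=
      l * `|\sum_i Y (X i w) - N%:R * \int[mu]_x Y x|)%R].
  by apply/seteqP; split => w /=; rewrite ler_pM2l.
move/le_trans; apply; rewrite lee_fin ler_pM2l// ler_expR.
rewrite /bernstein_const; set v := _ `^ (2 * m); set e := expR (_ `^ m).
rewrite [leLHS](_ : _ = (N%:R * l ^+ 2) * (v * 2 * e) -
  (K + v * 2 * e) * (l * Num.sqrt (N%:R * t))); last by ring.
by rewrite l2 lt le_eqVlt; apply/orP; left; apply/eqP; ring.
Qed.

(** Where [W > kappa], [W^m <= (2m)^m exp(W/2) <= (2m)^m exp(-kappa/2) exp W]. The factor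
    [exp(-kappa/2) <= sqrt(t/N)] turns [N] into [sqrt(N t)]. *)
Lemma tail_mean (m : R) (D : Omega -> R) : 0 < m ->
  measurable_fun setT D -> (forall x, `|D x| <= W x `^ m) ->
  `|N%:R * \int[mu]_x (if W x <= kappa then 0 else D x)|
    <= (2 * m) `^ m * 2 * Num.sqrt (N%:R * t).
Proof.
move=> m0 mD DW.
have mY : measurable_fun setT (fun x => if W x <= kappa then 0 else D x).
  exact: measurable_fun_ifT.
have c0 : 0 <= (2 * m) `^ m * expR (- (kappa / 2)).
  by rewrite mulr_ge0 ?powR_ge0 ?expR_ge0.
have := le_norm_Rintegral_dominated mY (mcexpW _) _ (intcW c0).
rewrite normrM [`|N%:R|]ger0_norm// => H.
apply: (@le_trans _ _ (N%:R * ((2 * m) `^ m * expR (- (kappa / 2)) * 2))).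
  rewrite ler_wpM2l//; apply: H => x.
  case: (leP (W x) kappa) => [_|kW]; first by rewrite normr0 mulr_ge0 ?expR_ge0.
  apply: (le_trans (DW x)).
  apply: (le_trans (powR_le_expR (a := 2^-1) _ m0 (W0 x))) => //.
  rewrite invrK [m * 2]mulrC -mulrA ler_wpM2l ?powR_ge0// -expRD ler_expR.
  lra.
have -> : Num.sqrt (N%:R * t) = N%:R * Num.sqrt (t / N%:R).
  have {2}-> : N%:R = Num.sqrt (N%:R ^+ 2) :> R by rewrite sqrtr_sqr ger0_norm.
  rewrite -sqrtrM ?sqr_ge0//; congr Num.sqrt.
  by field; rewrite gt_eqF.
rewrite -[(2 * m) `^ m * expR _ * 2]mulrA [expR _ * 2]mulrC mulrCA.
rewrite mulrA [leRHS]mulrCA !mulrA [leRHS]mulrC mulrA.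
have p0 : 0 <= (2 * m) `^ m by exact: powR_ge0.
have s0 := sqrtr_ge0 (t / N%:R).
rewrite -subr_ge0.
rewrite [X in 0 <= X](_ : _ = 2 * (2 * m) `^ m * N%:R *
  (Num.sqrt (t / N%:R) - expR (- (kappa / 2)))); last by ring.
by rewrite !mulr_ge0 ?subr_ge0// ltW.
Qed.

(** Half of the tail of [W] has exponential moment at most [1 + exp(-kappa/2) E exp W <= 1 + 2t/N],
    whose [N]-th power is at most [exp(2t)]. This is the origin of [K + 2], and the factor 2 undoes
    the halving. *)
Lemma tail_mass (K : R) :
  (P [set w | (2 * (K + 2) * t <=
      \sum_i (if W (X i w) <= kappa then 0 else W (X i w)))%R] <=
    (expR (- (K * t)))%:E)%E.
Proof.
pose h x := 2^-1 * (if W x <= kappa then 0 else W x).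
have mh : measurable_fun setT h.
  by apply: measurable_funM => //; exact: measurable_fun_ifT.
have c0 : 0 <= expR (- (kappa / 2)) by exact: expR_ge0.
have hb : (\int[mu]_x (expR (h x))%:E <= (expR (2 * (t / N%:R)))%:E)%E.
  have m1 : measurable_fun setT (fun x => 1 + expR (- (kappa / 2)) * expR (W x)).
    exact: measurable_funD.
  apply: (le_integral_fin _ m1).
  - exact: measurableT_comp.
  - by move=> x; exact: expR_ge0.
  - move=> x; rewrite /h; case: (leP (W x) kappa) => [_|kW].
      by rewrite mulr0 expR0 lerDl mulr_ge0 ?expR_ge0.
    rewrite -expRD; apply: ler_wpDl => //; rewrite ler_expR; lra.
  under eq_integral do rewrite EFinD.
  rewrite ge0_integralD//; last exact/measurable_EFinP.
  rewrite integral_probability_cst.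
  apply: (le_trans (leeD2l _ (intcW c0))).
  rewrite -EFinD lee_fin (le_trans _ (expR_ge1Dx _))// lerD2l mulrC.
  by rewrite ler_pM2l.
have := chernoff ((K + 2) * t) iidX mh hb.
have -> : N%:R * (2 * (t / N%:R)) - (K + 2) * t = - (K * t).
  by field; rewrite gt_eqF.
have <-// : [set w | (2 * (K + 2) * t <=
      \sum_i (if W (X i w) <= kappa then 0 else W (X i w)))%R] =
  [set w | ((K + 2) * t <= \sum_i h (X i w))%R].
apply/seteqP; split => w /=; rewrite -mulr_sumr ler_pdivlMl// mulrA//.
Qed.

(** Only the mean of the tail of [D] is estimated here. Its sum over the sample stays on the right,
    to be treated pointwise in [w] by means of the tail mass of [W]. *)
Lemma truncated_deviation (m K : R) (D : Omega -> R) : 0 < m ->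
  measurable_fun setT D -> (forall x, `|D x| <= W x `^ m) ->
  exists B : set T, [/\ measurable B, (P B <= (2 * expR (- (K * t)))%:E)%E &
    forall w, ~ B w ->
      `|\sum_i D (X i w) - N%:R * \int[mu]_x D x| <=
      (bernstein_const m K + (2 * m) `^ m * 2) * Num.sqrt (N%:R * t) +
      \sum_i (kappa < W (X i w))%R%:R * `|D (X i w)|].
Proof.
move=> m0 mD DW.
pose Y x := if W x <= kappa then D x else 0.
pose Y' x := if W x <= kappa then 0 else D x.
have mY : measurable_fun setT Y by exact: measurable_fun_ifT.
have mY' : measurable_fun setT Y' by exact: measurable_fun_ifT.
have iD (Z : Omega -> R) : measurable_fun setT Z ->
    (forall x, `|Z x| <= W x `^ m) -> mu.-integrable setT (EFin \o Z).
  move=> mZ ZW.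
  apply: (integrable_dominated mZ (mcexpW _) _ (intcW (powR_ge0 m m))) => x.
  apply: (le_trans (ZW x)); have := powR_le_expR ltr01 m0 (W0 x).
  by rewrite divr1 mul1r.
have iY : mu.-integrable setT (EFin \o Y).
  apply: iD => // x; rewrite /Y; case: (W x <= kappa) => //.
  by rewrite normr0 powR_ge0.
have iY' : mu.-integrable setT (EFin \o Y').
  apply: iD => // x; rewrite /Y'; case: (W x <= kappa) => //.
  by rewrite normr0 powR_ge0.
have ED : \int[mu]_x D x = \int[mu]_x Y x + \int[mu]_x Y' x.
  rewrite -RintegralD//; apply: eq_Rintegral => x _.
  by rewrite /Y /Y'; case: (W x <= kappa); rewrite ?addr0 ?add0r.
exists [set w | bernstein_const m K * Num.sqrt (N%:R * t) <=
      `|\sum_i Y (X i w) - N%:R * \int[mu]_x Y x|]; split.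
- apply: measurable_set_le => //; apply: measurableT_comp => //.
  apply: measurable_funB => //; apply: measurable_sum => i.
  exact: measurableT_comp.
- exact: truncated_bernstein.
- move=> w /= /negP; rewrite -ltNge => wB.
have SD : \sum_i D (X i w) = \sum_i Y (X i w) + \sum_i Y' (X i w).
  rewrite -big_split/=; apply: eq_bigr => i _.
  by rewrite /Y /Y'; case: (W (X i w) <= kappa); rewrite ?addr0 ?add0r.
have SY' : `|\sum_i Y' (X i w)| <= \sum_i (kappa < W (X i w))%R%:R * `|D (X i w)|.
  apply: (le_trans (ler_norm_sum _ _ _)); apply: ler_sum => i _.
  by rewrite /Y' ltNge; case: (W (X i w) <= kappa); rewrite /= ?normr0 ?mul0r ?mul1r.
have EY' := tail_mean m0 mD DW.
rewrite ED SD mulrDr opprD addrACA mulrDl.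
apply: (le_trans (ler_normD _ _)).
rewrite -addrA; apply: lerD; first exact: ltW.
by apply: (le_trans (ler_normB _ _)); rewrite addrC; exact: lerD.
Qed.

Lemma tail_mass_deviation (K : R) :
  exists B : set T, [/\ measurable B, (P B <= (expR (- (K * t)))%:E)%E &
    forall w, ~ B w ->
      \sum_i (kappa < W (X i w))%R%:R * W (X i w) <= 2 * (K + 2) * t].
Proof.
exists [set w | 2 * (K + 2) * t <=
      \sum_i (if W (X i w) <= kappa then 0 else W (X i w))]; split.
- apply: measurable_set_le => //; apply: measurable_sum => i.
  apply: (@measurableT_comp _ _ _ _ _ _ (fun x => if W x <= kappa then 0 else W x)) => //.
  exact: measurable_fun_ifT.
- exact: tail_mass.
move=> w /= /negP; rewrite -ltNge => /ltW; apply: le_trans; apply: ler_sum => i _.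
by rewrite ltNge; case: (W (X i w) <= kappa); rewrite /= ?mul0r ?mul1r.
Qed.

End TruncatedSums.

(** * Increments along a sample *)

Section FiniteSums.
Context {R : realType}.

Lemma sum_cauchy_schwarz (N : nat) (u v : 'I_N -> R) :
  \sum_i u i * v i <= Num.sqrt (\sum_i u i ^+ 2) * Num.sqrt (\sum_i v i ^+ 2).
Proof.
set U := \sum_i u i ^+ 2; set V := \sum_i v i ^+ 2; set S := \sum_i _.
have U0 : 0 <= U by apply: sumr_ge0 => i _; exact: sqr_ge0.
have V0 : 0 <= V by apply: sumr_ge0 => i _; exact: sqr_ge0.
have H x : 0 <= U * x ^+ 2 - 2 * S * x + V.
  rewrite [leRHS](_ : _ = \sum_i (u i * x - v i) ^+ 2).
    by apply: sumr_ge0 => i _; exact: sqr_ge0.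
  rewrite /U /V /S mulr_suml mulr_sumr mulr_suml -sumrB -big_split/=.
  by apply: eq_bigr => i _; ring.
rewrite -sqrtrM//; apply: (le_trans (ler_norm S)).
rewrite -sqrtr_sqr ler_wsqrtr//.
have [U1|U1] := eqVneq U 0.
  (* When [U = 0] the quadratic polynomial is affine, and nonnegativity at [(V + 1) / S] would give
     [- V - 2 >= 0]; hence [S = 0]. *)
  have := H ((V + 1) * S^-1); have [->|S0] := eqVneq S 0.
    by rewrite expr0n mulr_ge0.
  rewrite U1 mul0r sub0r -!mulrA [S * _]mulrC -!mulrA mulVf// mulr1; lra.
have Up : 0 < U by rewrite lt_neqAle eq_sym U1.
have := H (S / U).
have -> : U * (S / U) ^+ 2 - 2 * S * (S / U) + V = (U * V - S ^+ 2) / U by field.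
by rewrite pmulr_lge0 ?invr_gt0// subr_ge0.
Qed.

Lemma expR_mean3 (a b c : R) :
  expR (3^-1 * (a + b + c)) <= 3^-1 * (expR a + expR b + expR c).
Proof.
set m := 3^-1 * _.
have H x : expR m * (1 + (x - m)) <= expR x.
  by rewrite -[x in leRHS](subrKC m) expRD ler_pM2l ?expR_gt0// expR_ge1Dx.
have := lerD (lerD (H a) (H b)) (H c).
have -> : expR m * (1 + (a - m)) + expR m * (1 + (b - m)) + expR m * (1 + (c - m))
  = 3 * expR m by rewrite /m; field.
lra.
Qed.

(** The deterministic half of the estimate of one link: [s] marks the sample points above the
    truncation level and [E] is the centring. On the marked points the Lipschitz bound and
    Cauchy-Schwarz apply; squaring [|x|^(r-1)] produces the exponent [2(r-1)]. *)
Lemma increment_bound (N : nat) (s : 'I_N -> bool) (a b : 'I_N -> R)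
    (phi : R -> R) (r t d del c E : R) :
  power_lipschitz r phi -> 1 <= r -> 0 < t -> 0 < d -> 0 < del -> 0 <= c ->
  \sum_i (s i)%:R * (`|a i - b i| ^+ 2 / del ^+ 2) <= c * t ->
  `|\sum_i (phi (a i) - phi (b i)) - E| <=
     c * Num.sqrt (N%:R * t) * (del * d `^ (r - 1))
       + \sum_i (s i)%:R * `|phi (a i) - phi (b i)| ->
  `|\sum_i (phi (a i) - phi (b i)) - E| <=
    (c + r * Num.sqrt c) * (Num.sqrt t * del) *
      (Num.sqrt N%:R * d `^ (r - 1) + Num.sqrt (\sum_i `|a i| `^ (2 * (r - 1))) +
       Num.sqrt (\sum_i `|b i| `^ (2 * (r - 1)))).
Proof.
move=> lip r1 t0 d0 del0 c0 hs /le_trans; apply.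
set A := \sum_i `|a i| `^ _; set B := \sum_i `|b i| `^ _.
have r0 : 0 <= r by lra.
have cs (x : 'I_N -> R) : \sum_i (s i)%:R * `|a i - b i| * `|x i| `^ (r - 1)
    <= Num.sqrt c * (Num.sqrt t * del) * Num.sqrt (\sum_i `|x i| `^ (2 * (r - 1))).
  apply: (le_trans (sum_cauchy_schwarz _ _)).
  have -> : \sum_i (`|x i| `^ (r - 1)) ^+ 2 = \sum_i `|x i| `^ (2 * (r - 1)).
    by apply: eq_bigr => i _; rewrite mulrC powRrM powR_mulrn ?powR_ge0.
  apply: ler_wpM2r; first exact: sqrtr_ge0.
  have -> : Num.sqrt c * (Num.sqrt t * del) = Num.sqrt (c * t * del ^+ 2).
    rewrite sqrtrM ?mulr_ge0 ?(ltW t0)// sqrtr_sqr gtr0_norm// sqrtrM//.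
    by rewrite mulrA.
  apply: ler_wsqrtr; rewrite -ler_pdivrMr ?exprn_gt0// mulr_suml.
  apply: le_trans hs; apply: ler_sum => i _.
  by rewrite exprMn -mulrA; case: (s i); rewrite ?expr1n ?expr0n ?mul0r.
have step : \sum_i (s i)%:R * `|phi (a i) - phi (b i)| <=
    r * (Num.sqrt c * (Num.sqrt t * del)) * (Num.sqrt A + Num.sqrt B).
  apply: (@le_trans _ _ (r * (\sum_i (s i)%:R * `|a i - b i| * `|a i| `^ (r - 1) +
      \sum_i (s i)%:R * `|a i - b i| * `|b i| `^ (r - 1)))).
    rewrite -big_split/= mulr_sumr; apply: ler_sum => i _.
    rewrite -mulrDr; case: (s i); last by rewrite !mul0r mulr0.
    by rewrite !mul1r mulrA; exact: lip.
  by rewrite -mulrA ler_wpM2l// mulrDr lerD// cs.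
have sA := sqrtr_ge0 A; have sB := sqrtr_ge0 B.
have sN := sqrtr_ge0 (N%:R : R).
have sc := sqrtr_ge0 c.
have st : 0 <= Num.sqrt t * del by rewrite mulr_ge0 ?sqrtr_ge0 ?ltW.
apply: (le_trans (lerD (lexx _) step)).
rewrite sqrtrM ?ler0n//.
have dr : 0 <= d `^ (r - 1) by exact: powR_ge0.
set x := Num.sqrt t * del in st *.
rewrite [X in X + _ <= _](_ : _ = c * x * (Num.sqrt N%:R * d `^ (r - 1))); last first.
  by rewrite /x; ring.
rewrite -subr_ge0.
rewrite [leRHS](_ : _ = c * (x * (Num.sqrt A + Num.sqrt B)) +
  r * (Num.sqrt c * (x * (Num.sqrt N%:R * d `^ (r - 1))))); last by ring.
by apply: addr_ge0; repeat (apply: mulr_ge0 => //); exact: addr_ge0.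
Qed.

End FiniteSums.

(** * The psi_2 norm *)

Section Orlicz.
Context {R : realType} {dO : measure_display} {Omega : measurableType dO}.
Variable mu : probability Omega R.

(** An explicit admissible constant for [f] in place of a bound on [psi2_norm]: it stays in the
    reals and avoids the question whether the infimum is attained. *)
Definition orlicz_le (c : R) (f : Omega -> R) : Prop :=
  0 < c /\ (\int[mu]_x (expR (`|f x| ^+ 2 / c ^+ 2)%R)%:E <= 2%:E)%E.

Lemma measurable_orlicz (c : R) (f : Omega -> R) : measurable_fun setT f ->
  measurable_fun setT (fun x => `|f x| ^+ 2 / c ^+ 2).
Proof.
move=> mf; apply: measurable_funM => //; apply: measurable_funX.
exact: measurableT_comp.
Qed.

Lemma measurable_expR_orlicz (c : R) (f : Omega -> R) : measurable_fun setT f ->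
  measurable_fun setT (fun x => expR (`|f x| ^+ 2 / c ^+ 2)).
Proof. by move=> mf; apply: measurableT_comp => //; exact: measurable_orlicz. Qed.

Lemma orlicz_le_trans (c c' : R) (f g : Omega -> R) :
  measurable_fun setT f -> measurable_fun setT g -> 0 < c' ->
  (forall x, `|f x| / c' <= `|g x| / c) -> orlicz_le c g -> orlicz_le c' f.
Proof.
move=> mf mg c'0 fg [c0 gc]; split => //.
apply: (le_integral_fin _ (measurable_expR_orlicz c mg) _ _ gc).
- exact: measurable_expR_orlicz.
- by move=> x; exact: expR_ge0.
- move=> x; rewrite ler_expR -!expr_div_n lerXn2r ?nnegrE ?divr_ge0// ltW//.
Qed.

(** With [a = |f|^2/c1^2] and [b = |g|^2/c2^2], one has [|f+g|^2 <= 2 |f|^2 + 2 |g|^2 <= 2 (a+b)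
    (c1+c2)^2], so the normalised square is at most the mean of [a] and [b], and convexity of the
    exponential concludes. The factor 2 lost against the triangle inequality only affects
    constants. *)
Lemma orlicz_leD (c1 c2 : R) (f g : Omega -> R) :
  measurable_fun setT f -> measurable_fun setT g ->
  orlicz_le c1 f -> orlicz_le c2 g -> orlicz_le (2 * (c1 + c2)) (f \+ g).
Proof.
move=> mf mg [c10 fc] [c20 gc]; have c0 : 0 < 2 * (c1 + c2) by lra.
split => //.
have mef := measurable_expR_orlicz c1 mf; have meg := measurable_expR_orlicz c2 mg.
pose h x := 2^-1 * (expR (`|f x| ^+ 2 / c1 ^+ 2) + expR (`|g x| ^+ 2 / c2 ^+ 2)).
have mh : measurable_fun setT h.
  by apply: measurable_funM => //; exact: measurable_funD.
apply: (le_integral_fin _ mh).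
- by apply: measurable_expR_orlicz; exact: measurable_funD.
- by move=> x; exact: expR_ge0.
- move=> x; rewrite /h.
  set a := _ / c1 ^+ 2; set b := _ / c2 ^+ 2.
  have half : expR (2^-1 * (a + b)) <= 2^-1 * (expR a + expR b).
    have Ea := expR_ge1Dx (2^-1 * (a - b)).
    have Eb := expR_ge1Dx (2^-1 * (b - a)).
    have -> : expR a = expR (2^-1 * (a + b)) * expR (2^-1 * (a - b)).
      by rewrite -expRD; congr expR; field.
    have -> : expR b = expR (2^-1 * (a + b)) * expR (2^-1 * (b - a)).
      by rewrite -expRD; congr expR; field.
    have := expR_gt0 (2^-1 * (a + b)); nra.
  apply: le_trans half; rewrite ler_expR ler_pdivrMr ?exprn_gt0//.
  have fa : `|f x| ^+ 2 = a * c1 ^+ 2 by rewrite /a divfK// gt_eqF ?exprn_gt0.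
  have gb : `|g x| ^+ 2 = b * c2 ^+ 2 by rewrite /b divfK// gt_eqF ?exprn_gt0.
  have a0 : 0 <= a by rewrite divr_ge0 ?sqr_ge0.
  have b0 : 0 <= b by rewrite divr_ge0 ?sqr_ge0.
  have n0 := normr_ge0 (f x + g x).
  have tri : `|f x + g x| ^+ 2 <= 2 * (a * c1 ^+ 2) + 2 * (b * c2 ^+ 2).
    have t1 := ler_normD (f x) (g x).
    have := normr_ge0 (f x); have := normr_ge0 (g x).
    have := sqr_ge0 (`|f x| - `|g x|); rewrite -fa -gb /=; nra.
  have k1 : a * c1 ^+ 2 <= a * (c1 + c2) ^+ 2.
    by rewrite ler_wpM2l// lerXn2r ?nnegrE; lra.
  have k2 : b * c2 ^+ 2 <= b * (c1 + c2) ^+ 2.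
    by rewrite ler_wpM2l// lerXn2r ?nnegrE; lra.
  rewrite /=; apply: (le_trans tri); rewrite exprMn; lra.
under eq_integral do rewrite EFinM EFinD.
rewrite ge0_integralZl_EFin//; last 2 first.
- by move=> x _; rewrite adde_ge0 ?lee_fin ?expR_ge0.
- apply: emeasurable_funD; exact/measurable_EFinP.
rewrite ge0_integralD//; try exact/measurable_EFinP.
apply: (@le_trans _ _ ((2^-1)%:E * (2%:E + 2%:E))%E).
  by rewrite lee_pmul2l ?lte_fin//; exact: leeD.
by rewrite -EFinD -EFinM lee_fin; lra.
Qed.

Lemma orlicz_moment (q c : R) (f : Omega -> R) : 0 < q ->
  measurable_fun setT f -> orlicz_le c f ->
  (\int[mu]_x (`|f x| `^ q)%:E <= ((q / 2) `^ (q / 2) * 2 * c `^ q)%:E)%E.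
Proof.
move=> q0 mf [c0 fc].
have q20 : 0 < q / 2 by rewrite divr_gt0.
pose h x := (c `^ q * (q / 2) `^ (q / 2)) * expR (`|f x| ^+ 2 / c ^+ 2).
have me := measurable_expR_orlicz c mf.
have mh : measurable_fun setT h by exact: measurable_funM.
apply: (le_integral_fin _ mh).
- apply: (measurableT_comp (measurable_powR q)); exact: measurableT_comp.
- by move=> x; exact: powR_ge0.
- move=> x; rewrite /h -mulrA.
  have -> : `|f x| `^ q = c `^ q * (`|f x| ^+ 2 / c ^+ 2) `^ (q / 2).
    rewrite -expr_div_n -powR_mulrn ?divr_ge0 ?(ltW c0)// -powRrM.
    have -> : 2%:R * (q / 2) = q by field.
    rewrite -powRM ?divr_ge0 ?(ltW c0)//; congr powR.
    by rewrite mulrC divfK// gt_eqF.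
  rewrite ler_wpM2l ?powR_ge0//.
  have := powR_le_expR ltr01 q20 (_ : 0 <= `|f x| ^+ 2 / c ^+ 2).
  by rewrite divr1 mul1r; apply; rewrite divr_ge0 ?sqr_ge0.
under eq_integral do rewrite EFinM.
rewrite ge0_integralZl_EFin ?mulr_ge0 ?powR_ge0//; last exact/measurable_EFinP.
apply: (@le_trans _ _ ((c `^ q * (q / 2) `^ (q / 2))%:E * 2%:E)%E).
  by rewrite lee_wpmul2l// lee_fin mulr_ge0 ?powR_ge0.
by rewrite -EFinM lee_fin le_eqVlt; apply/orP; left; apply/eqP; ring.
Qed.

Lemma integrable_lipschitz (phi : R -> R) (r c : R) (f : Omega -> R) :
  1 <= r -> measurable_fun setT phi -> power_lipschitz r phi -> phi 0 = 0 ->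
  measurable_fun setT f -> orlicz_le c f ->
  mu.-integrable setT (EFin \o (phi \o f)).
Proof.
move=> r1 mphi lip phi0 mf fc.
have r0 : 0 < r by lra.
have mf' : measurable_fun setT (fun x => r * `|f x| + (r * 2) * `|f x| `^ r).
  apply: measurable_funD; apply: measurable_funM => //.
    exact: measurableT_comp.
  apply: (measurableT_comp (measurable_powR r)); exact: measurableT_comp.
have mpr : measurable_fun setT (fun x => `|f x| `^ r).
  apply: (measurableT_comp (measurable_powR r)); exact: measurableT_comp.
have mn : measurable_fun setT (fun x => `|f x|) by exact: measurableT_comp.
have m1 := orlicz_moment r0 mf fc.
have m2 := orlicz_moment ltr01 mf fc.
have i1 : mu.-integrable setT (EFin \o (fun x => `|f x| `^ r)).
  by apply: integrable_dominated m1 => // x; rewrite ger0_norm ?powR_ge0.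
have i2 : mu.-integrable setT (EFin \o (fun x => `|f x|)).
  apply: (integrable_dominated _ _ _ m2) => //.
    apply: (measurableT_comp (measurable_powR 1)); exact: measurableT_comp.
  by move=> x; rewrite powRr1// normr_id.
have i3 : mu.-integrable setT
    (fun x => r%:E * (`|f x|)%:E + (r * 2)%:E * (`|f x| `^ r)%:E)%E.
  by apply: integrableD => //; exact: integrableZl.
apply: le_integrable i3 => //.
  by apply/measurable_EFinP; exact: measurableT_comp.
move=> x _ /=; rewrite lee_fin.
have := lip (f x) 0; rewrite phi0 !subr0 normr0 => /le_trans; apply.
apply: le_trans (ler_norm _).
(* At [r = 1] this is [0^0 = 1], which is why the dominating function has a linear term besides
   [|f|^r]. *)
have z1 : 0 `^ (r - 1) <= 1 :> R.
  have [->|rn1] := eqVneq r 1; first by rewrite subrr powRr0.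
  by rewrite powR0// subr_eq0.
have fp := normr_ge0 (f x); have pp := powR_ge0 (`|f x|) r.
rewrite -mulrA mulrDr (mulr_powRB1 fp r0) mulrDr.
have k1 : r * (`|f x| * 0 `^ (r - 1)) <= r * `|f x|.
  by rewrite ler_wpM2l ?(ltW r0)// ler_piMr.
have k2 : 0 <= r * `|f x| `^ r by rewrite mulr_ge0// ltW.
lra.
Qed.

End Orlicz.

(** * Deviation of one increment *)

Definition deviation {R : realType} {dO dT : measure_display}
    {Omega : measurableType dO} {T : measurableType dT}
    (mu : probability Omega R) (N : nat) (X : 'I_N -> {mfun T >-> Omega})
    (phi : R -> R) (f : Omega -> R) (w : T) : R :=
  \sum_i phi (f (X i w)) - N%:R * \int[mu]_x phi (f x).

Definition power_sum {R : realType} {dO dT : measure_display}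
    {Omega : measurableType dO} {T : measurableType dT}
    (N : nat) (X : 'I_N -> {mfun T >-> Omega})
    (q : R) (f : Omega -> R) (w : T) : R :=
  \sum_i `|f (X i w)| `^ q.

Section PairDeviation.
Context {R : realType} {dO dT : measure_display}.
Context {Omega : measurableType dO} {T : measurableType dT}.
Variables (mu : probability Omega R) (P : probability T R).
Variables (N : nat) (X : 'I_N -> {mfun T >-> Omega}).
Variables (g h : Omega -> R) (d del t : R).
Hypotheses (N0 : (0 < N)%N) (iidX : iid_with_law P mu X) (t0 : 0 < t).
Hypotheses (mg : measurable_fun setT g) (mh : measurable_fun setT h).
Hypotheses (gd : orlicz_le mu d g) (hd : orlicz_le mu d h).
Hypothesis ghd : orlicz_le mu del (g \- h).

Let d0 : 0 < d. Proof. by case: gd. Qed.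
Let del0 : 0 < del. Proof. by case: ghd. Qed.

Let W x : R := 3^-1 * (`|g x - h x| ^+ 2 / del ^+ 2 + `|g x| ^+ 2 / d ^+ 2
                       + `|h x| ^+ 2 / d ^+ 2).

Let W0 x : 0 <= W x.
Proof. by rewrite mulr_ge0// !addr_ge0// divr_ge0// sqr_ge0. Qed.

Let mgh : measurable_fun setT (g \- h).
Proof. exact: measurable_funB. Qed.

Let mW : measurable_fun setT W.
Proof.
apply: measurable_funM => //; apply: measurable_funD.
  by apply: measurable_funD; [exact: (measurable_orlicz del mgh)|exact: measurable_orlicz].
exact: measurable_orlicz.
Qed.

Let intW : (\int[mu]_x (expR (W x))%:E <= 2%:E)%E.
Proof.
have ma := measurable_expR_orlicz del mgh.
have mb := measurable_expR_orlicz d mg.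
have mc := measurable_expR_orlicz d mh.
pose V x := 3^-1 * (expR (`|g x - h x| ^+ 2 / del ^+ 2) + expR (`|g x| ^+ 2 / d ^+ 2)
                       + expR (`|h x| ^+ 2 / d ^+ 2)).
have mab : measurable_fun setT (fun x =>
  expR (`|g x - h x| ^+ 2 / del ^+ 2) + expR (`|g x| ^+ 2 / d ^+ 2)).
  exact: measurable_funD.
have mV : measurable_fun setT V.
  by apply: measurable_funM => //; exact: measurable_funD.
apply: (le_integral_fin _ mV).
- exact: measurableT_comp.
- by move=> x; exact: expR_ge0.
- by move=> x; exact: expR_mean3.
under eq_integral do rewrite EFinM.
rewrite ge0_integralZl_EFin//; last by apply/measurable_EFinP; exact: measurable_funD.
under eq_integral do rewrite EFinD.
rewrite ge0_integralD//; last 2 first.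
- exact/measurable_EFinP.
- exact/measurable_EFinP.
under eq_integral do rewrite EFinD.
rewrite ge0_integralD//; last 2 first.
- exact/measurable_EFinP.
- exact/measurable_EFinP.
apply: (@le_trans _ _ ((3^-1)%:E * (2%:E + 2%:E + 2%:E))%E).
  rewrite lee_pmul2l ?lte_fin//; apply: leeD; last exact: hd.2.
  by apply: leeD; [exact: ghd.2|exact: gd.2].
by rewrite -!EFinD -EFinM lee_fin; lra.
Qed.

Let W_le (y z k : R) : 0 < k -> `|y| ^+ 2 / k ^+ 2 <= 3 * z ->
  `|y| <= k * Num.sqrt (3 * z).
Proof.
move=> k0 yz; rewrite mulrC -ler_pdivrMr//.
rewrite -[leLHS]ger0_norm ?divr_ge0 ?(ltW k0)// -sqrtr_sqr.
by rewrite ler_wsqrtr// expr_div_n.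
Qed.

(** Each of [|g-h|/del], [|g|/d] and [|h|/d] is at most [v = sqrt(3W)]. The Lipschitz bound has
    degree 1 in the first and [r-1] in the others, so the increment is of order
    [v^r = (3W)^(r/2)]. *)
Let increment_le_W (phi : R -> R) (r : R) : 1 <= r -> power_lipschitz r phi ->
  forall x, `|(phi (g x) - phi (h x)) / (2 * r * 3 `^ (r / 2) * (del * d `^ (r - 1)))|
    <= W x `^ (r / 2).
Proof.
move=> r1 lip x; have r0 : 0 < r by lra.
have k0 : 0 < 2 * r * 3 `^ (r / 2) * (del * d `^ (r - 1)).
  by rewrite !mulr_gt0 ?powR_gt0.
rewrite normrM [`|_^-1|]gtr0_norm ?invr_gt0// ler_pdivrMr//.
apply: (le_trans (lip _ _)).
set v := Num.sqrt (3 * W x).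
have v0 : 0 <= v by exact: sqrtr_ge0.
have part : [/\ `|g x - h x| <= del * v, `|g x| <= d * v & `|h x| <= d * v].
  have a0 : 0 <= `|g x - h x| ^+ 2 / del ^+ 2 by rewrite divr_ge0 ?sqr_ge0.
  have b0 : 0 <= `|g x| ^+ 2 / d ^+ 2 by rewrite divr_ge0 ?sqr_ge0.
  have c0 : 0 <= `|h x| ^+ 2 / d ^+ 2 by rewrite divr_ge0 ?sqr_ge0.
  by split; apply: W_le => //; rewrite /W; lra.
case: part => p1 p2 p3.
have pw y : `|y| <= d * v -> `|y| `^ (r - 1) <= d `^ (r - 1) * v `^ (r - 1).
  move=> yd; rewrite -powRM ?(ltW d0)// ge0_ler_powR ?nnegrE ?mulr_ge0 ?(ltW d0)//.
  by rewrite subr_ge0.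
apply: (@le_trans _ _ (r * (del * v) * (d `^ (r - 1) * v `^ (r - 1) + d `^ (r - 1) * v `^ (r - 1)))).
  apply: ler_pM; rewrite ?mulr_ge0 ?(ltW r0)//.
  - by rewrite ler_wpM2l// ltW.
  - by apply: lerD; exact: pw.
have -> : W x `^ (r / 2) * (2 * r * 3 `^ (r / 2) * (del * d `^ (r - 1))) =
   2 * r * del * d `^ (r - 1) * v `^ r.
  have -> : v `^ r = 3 `^ (r / 2) * W x `^ (r / 2).
    have -> : v = (3 * W x) `^ (2^-1) by rewrite powR12_sqrt// mulr_ge0.
    by rewrite -powRM// -powRrM mulrC [2^-1 * r]mulrC.
  by ring.
rewrite -(mulr_powRB1 v0 r0).
by rewrite le_eqVlt; apply/orP; left; apply/eqP; ring.
Qed.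

(* The unnormalised increment is (2 r 3^(r/2) del d^(r-1)) times a function
   dominated by W^(r/2), see [increment_le_W]. *)
Definition pair_const (r K : R) : R :=
  let c := 2 * r * 3 `^ (r / 2) * (bernstein_const (r / 2) K + (2 * (r / 2)) `^ (r / 2) * 2)
           + 6 * (K + 2) in
  c + r * Num.sqrt c.

Definition pair_bound (c r : R) (phi : R -> R) (w : T) : Prop :=
  `|deviation mu X phi g w - deviation mu X phi h w| <=
    c * (Num.sqrt t * del) * (Num.sqrt N%:R * d `^ (r - 1) +
      Num.sqrt (power_sum X (2 * (r - 1)) g w) +
      Num.sqrt (power_sum X (2 * (r - 1)) h w)).

(** The interface through which powers enter the chaining; [phi 0 = 0] makes the deviation vanish at
    the start of the chain. *)
Definition power_like (r : R) (phi : R -> R) : Prop :=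
  [/\ 1 <= r, measurable_fun setT phi, power_lipschitz r phi & phi 0 = 0].

Let pair_bound_of_truncated (r K kappa : R) (phi : R -> R) (w : T) :
  0 <= K -> power_like r phi ->
  let D x := (phi (g x) - phi (h x)) / (2 * r * 3 `^ (r / 2) * (del * d `^ (r - 1))) in
  `|\sum_i D (X i w) - N%:R * \int[mu]_x D x| <=
      (bernstein_const (r / 2) K + (2 * (r / 2)) `^ (r / 2) * 2) * Num.sqrt (N%:R * t) +
      \sum_i (kappa < W (X i w))%R%:R * `|D (X i w)| ->
  \sum_i (kappa < W (X i w))%R%:R * W (X i w) <= 2 * (K + 2) * t ->
  pair_bound (pair_const r K) r phi w.
Proof.
move=> K0 [r1 mphi lip phi0] D hD hW.
have r0 : 0 < r by lra.
pose k := 2 * r * 3 `^ (r / 2) * (del * d `^ (r - 1)).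
have k0 : 0 < k by rewrite !mulr_gt0 ?powR_gt0.
have kN0 : k != 0 by rewrite gt_eqF.
have ig := integrable_lipschitz r1 mphi lip phi0 mg gd.
have ih := integrable_lipschitz r1 mphi lip phi0 mh hd.
have igh : mu.-integrable setT (EFin \o (fun x => phi (g x) - phi (h x))).
  exact: (integrableB _ ig ih).
have DE : \int[mu]_x D x = k^-1 * (\int[mu]_x phi (g x) - \int[mu]_x phi (h x)).
  rewrite -RintegralB// -RintegralZl//; apply: eq_Rintegral => x _.
  by rewrite /D mulrC.
have b0 : 0 <= bernstein_const (r / 2) K + (2 * (r / 2)) `^ (r / 2) * 2.
  by rewrite !addr_ge0 ?mulr_ge0 ?powR_ge0 ?expR_ge0.
set C1 := _ + _ `^ _ * 2 in hD b0.
pose c := 2 * r * 3 `^ (r / 2) * C1 + 6 * (K + 2).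
have c1 : 0 <= 2 * r * 3 `^ (r / 2) * C1 by rewrite !mulr_ge0 ?powR_ge0// ltW.
have c0 : 0 <= c by rewrite addr_ge0// mulr_ge0// addr_ge0.
have devE : deviation mu X phi g w - deviation mu X phi h w =
  \sum_i (phi (g (X i w)) - phi (h (X i w))) -
    N%:R * (\int[mu]_x phi (g x) - \int[mu]_x phi (h x)).
  by rewrite /deviation sumrB; ring.
rewrite /pair_bound devE /pair_const -/C1 -/c.
apply: (increment_bound lip r1 t0 d0 del0 c0 (s := fun i => (kappa < W (X i w))%R)).
  (* The factor 3 undoes the [3^-1] in [W]; together with [2 (K + 2)] it gives the summand
     [6 (K + 2)] of the constant. *)
  apply: (@le_trans _ _ (3 * (\sum_i (kappa < W (X i w))%R%:R * W (X i w)))).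
    rewrite mulr_sumr; apply: ler_sum => i _.
    case: (kappa < W _); last by rewrite !mul0r mulr0.
    rewrite !mul1r /W.
    have b1 : 0 <= `|g (X i w)| ^+ 2 / d ^+ 2 by rewrite divr_ge0 ?sqr_ge0.
    have b2 : 0 <= `|h (X i w)| ^+ 2 / d ^+ 2 by rewrite divr_ge0 ?sqr_ge0.
    lra.
  rewrite /c [leRHS]mulrDl; have := mulr_ge0 c1 (ltW t0); lra.
move: hD; rewrite DE.
have -> : \sum_i D (X i w) = k^-1 * \sum_i (phi (g (X i w)) - phi (h (X i w))).
  by rewrite mulr_sumr; apply: eq_bigr => i _; rewrite /D mulrC.
have -> : \sum_i (kappa < W (X i w))%R%:R * `|D (X i w)| =
   k^-1 * \sum_i (kappa < W (X i w))%R%:R * `|phi (g (X i w)) - phi (h (X i w))|.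
  rewrite mulr_sumr; apply: eq_bigr => i _; rewrite /D normrM.
  by rewrite -/k [`|k^-1|]gtr0_norm ?invr_gt0// mulrA mulrC.
rewrite mulrCA -mulrBr normrM gtr0_norm ?invr_gt0// ler_pdivrMl//.
move/le_trans; apply; rewrite mulrDr mulVKf// lerD2r.
rewrite /k /c.
set sN := Num.sqrt _; have sN0 : 0 <= sN by exact: sqrtr_ge0.
rewrite -subr_ge0.
rewrite [leRHS](_ : _ = 6 * (K + 2) * sN * (del * d `^ (r - 1))); last by ring.
have dp : 0 <= d `^ (r - 1) by exact: powR_ge0.
by rewrite !mulr_ge0 ?(ltW del0)// addr_ge0.
Qed.

(** Both exponents use the same [W] and the same truncation level, so the tail mass event is shared:
    the exceptional probabilities add up as [2 + 2 + 1]. *)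
Lemma pair_deviation (K r1 r2 : R) (phi1 phi2 : R -> R) :
  0 <= K -> power_like r1 phi1 -> power_like r2 phi2 ->
  exists B : set T, [/\ measurable B, (P B <= (5 * expR (- (K * t)))%:E)%E &
    forall w, ~ B w -> pair_bound (pair_const r1 K) r1 phi1 w /\
                       pair_bound (pair_const r2 K) r2 phi2 w].
Proof.
move=> K0 p1 p2.
have NR0 : 0 < N%:R :> R by rewrite ltr0n.
have [kappa kappa0 [kt ks kp]] := truncation_level t0 NR0.
have md phi r : power_like r phi -> measurable_fun setT (fun x =>
    (phi (g x) - phi (h x)) / (2 * r * 3 `^ (r / 2) * (del * d `^ (r - 1)))).
  move=> [_ mphi _ _]; apply: measurable_funM => //; apply: measurable_funB.
    exact: measurableT_comp.
  exact: measurableT_comp.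
have r20 r phi : power_like r phi -> 0 < r / 2.
  by move=> [r1' _ _ _]; rewrite divr_gt0//; lra.
have dl r phi : power_like r phi -> forall x,
    `|(phi (g x) - phi (h x)) / (2 * r * 3 `^ (r / 2) * (del * d `^ (r - 1)))|
    <= W x `^ (r / 2).
  by move=> [r1' _ lip _]; exact: increment_le_W.
have [B1 [mB1 PB1 HB1]] := truncated_deviation N0 iidX t0 mW W0 intW kappa0 ks kp
  K (r20 _ _ p1) (md _ _ p1) (dl _ _ p1).
have [B2 [mB2 PB2 HB2]] := truncated_deviation N0 iidX t0 mW W0 intW kappa0 ks kp
  K (r20 _ _ p2) (md _ _ p2) (dl _ _ p2).
have [B3 [mB3 PB3 HB3]] := tail_mass_deviation N0 iidX mW intW kt K.
exists (B1 `|` B2 `|` B3); split.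
- by apply: measurableU => //; exact: measurableU.
- have m12 : measurable (B1 `|` B2) by exact: measurableU.
  apply: (le_trans (measureU2 _ m12 mB3)).
  have -> : ((5 * expR (- (K * t)))%:E = (2 * expR (- (K * t)))%:E +
      (2 * expR (- (K * t)))%:E + (expR (- (K * t)))%:E)%E.
    by rewrite -!EFinD; congr EFin; ring.
  apply: leeD => //; apply: (le_trans (measureU2 _ mB1 mB2)); exact: leeD.
move=> w /not_orP[/not_orP[w1 w2] w3]; split.
- exact: (pair_bound_of_truncated K0 p1 (HB1 _ w1) (HB3 _ w3)).
- exact: (pair_bound_of_truncated K0 p2 (HB2 _ w2) (HB3 _ w3)).
Qed.

End PairDeviation.

(** * Summation along a chain *)

Section Chain.
Context {R : realType}.

Lemma sum_powR_le (N : nat) (y : 'I_N -> R) (e : R) : 1 <= e ->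
  (forall i, 0 <= y i) -> \sum_i y i `^ e <= (\sum_i y i) `^ e.
Proof.
move=> e1 y0; have e0 : 0 < e by lra.
have S0 : 0 <= \sum_i y i by apply: sumr_ge0.
rewrite -(mulr_powRB1 S0 e0) mulr_suml; apply: ler_sum => i _.
rewrite -(mulr_powRB1 (y0 i) e0) ler_wpM2l//.
rewrite ge0_ler_powR ?nnegrE ?subr_ge0//.
by rewrite (bigD1 i)//= lerDl sumr_ge0.
Qed.

Lemma powRD_le (a b e : R) : 0 <= e -> 0 <= a -> 0 <= b ->
  (a + b) `^ e <= 2 `^ e * (a `^ e + b `^ e).
Proof.
move=> e0 a0 b0.
wlog ab : a b a0 b0 / a <= b => [hw|].
  have [/hw|/ltW/hw] := leP a b; first exact.
  by rewrite addrC [a `^ e + _]addrC; exact.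
apply: (@le_trans _ _ ((2 * b) `^ e)).
  by rewrite ge0_ler_powR ?nnegrE ?addr_ge0 ?mulr_ge0//; lra.
by rewrite powRM// ler_wpM2l ?powR_ge0// lerDr powR_ge0.
Qed.

Lemma telescope_le (V b : nat -> R) (n k : nat) (c U Y : R) :
  0 <= c -> 0 <= Y -> (forall j, 0 <= b j) -> \sum_(j < n) b j <= U ->
  V 0%N = 0 -> (forall j, (j < n)%N -> `|V j.+1 - V j| <= c * b j * Y) ->
  (k <= n)%N -> `|V k| <= c * U * Y.
Proof.
move=> c0 Y0 b0 bU V0 hV kn.
have H : `|V k| <= c * (\sum_(j < k) b j) * Y.
  elim: k kn => [_|k IH kn]; first by rewrite V0 normr0 big_ord0 mulr0 mul0r.
  rewrite big_ord_recr/= mulrDr mulrDl.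
  rewrite -[V k.+1](subrKC (V k)); apply: (le_trans (ler_normD _ _)).
  by apply: lerD; [exact: IH (ltnW kn)|exact: hV].
apply: (le_trans H); rewrite ler_wpM2r// ler_wpM2l//; apply: le_trans bU.
rewrite -(big_mkord xpredT) -(big_mkord xpredT b) (big_cat_nat (n := k) _ kn)//=.
by rewrite lerDl sumr_ge0.
Qed.

(** If [M <= B] the summand 1 suffices. Otherwise each [B^(q-1)] on the right is at most [M^(q-1)],
    which then cancels. *)
Lemma self_bounded (M B c C0 q : R) : 1 <= q -> 0 <= M -> 0 <= B -> 0 <= c -> 0 <= C0 ->
  M `^ q <= c * B * (B `^ (q - 1) + 2 * M `^ (q - 1)) + C0 * B `^ q ->
  M <= (3 * c + C0 + 1) * B.
Proof.
move=> q1 M0 B0 c0 C00; have q0 : 0 < q by lra.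
rewrite -(mulr_powRB1 M0 q0) -(mulr_powRB1 B0 q0).
have [MB _|/ltW BM] := leP M B.
  apply: (le_trans MB); rewrite ler_peMl//; nra.
have Bq : B `^ (q - 1) <= M `^ (q - 1).
  by rewrite ge0_ler_powR ?nnegrE ?subr_ge0.
have [->|Mn0] := eqVneq M 0; first by move=> _; rewrite mulr_ge0// !addr_ge0// mulr_ge0.
have Mp : 0 < M by rewrite lt_neqAle eq_sym Mn0.
have Mq : 0 < M `^ (q - 1) by exact: powR_gt0.
set m := M `^ _ in Bq Mq *; set b := B `^ _ in Bq *.
move=> H; have : M * m <= ((3 * c + C0 + 1) * B) * m.
  apply: (le_trans H).
  have k1 : c * B * b <= c * B * m by rewrite ler_wpM2l// mulr_ge0.
  have k2 : C0 * B * b <= C0 * B * m by rewrite ler_wpM2l// mulr_ge0.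
  have k3 : 0 <= B * m by rewrite mulr_ge0// ltW.
  lra.
by rewrite ler_pM2r.
Qed.

(** Applied to the exponent [q], the link estimate involves sample norms of exponent [2(q-1)]. Since
    [p >= 2] gives [q >= 2], this exponent is at least [q], and the [l_q] norm dominates: the
    inequality closes at [q] and no further exponent appears. *)
Lemma chain_bound (p c C0 : R) : 2 <= p -> 0 <= c -> 0 <= C0 ->
  let q := 2 * (p - 1) in
  exists2 C, 0 < C & forall (n N : nat) (x : nat -> 'I_N -> R) (a : nat -> R)
    (d U : R) (V Vq e : nat -> R),
  let S r j := \sum_i `|x j i| `^ r in
  (0 < N)%N -> (forall j, 0 <= a j) -> \sum_(j < n) a j <= U -> 0 <= d ->
  V 0%N = 0 -> Vq 0%N = 0 ->
  (forall j, (j <= n)%N -> Vq j = S q j - N%:R * e j) ->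
  (forall j, (j <= n)%N -> e j <= C0 * d `^ q) ->
  (forall j, (j < n)%N -> `|Vq j.+1 - Vq j| <=
    c * a j * (Num.sqrt N%:R * d `^ (q - 1) + Num.sqrt (S (2 * (q - 1)) j.+1)
               + Num.sqrt (S (2 * (q - 1)) j))) ->
  (forall j, (j < n)%N -> `|V j.+1 - V j| <=
    c * a j * (Num.sqrt N%:R * d `^ (p - 1) + Num.sqrt (S q j.+1)
               + Num.sqrt (S q j))) ->
  `|V n| <= C * (U * (Num.sqrt N%:R * d `^ (p - 1)) + U `^ p).
Proof.
move=> p2 c0 C00 q.
have q2 : 2 <= q by rewrite /q; lra.
have q0 : 0 < q by lra.
pose A := 3 * c + C0 + 1.
have A0 : 0 <= A by rewrite !addr_ge0// mulr_ge0.
have tA0 : 0 <= (2 * A) `^ (p - 1) by exact: powR_ge0.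
exists (c * (1 + 2 * (2 * A) `^ (p - 1)) + 1).
  by rewrite ltr_wpDl// mulr_ge0// addr_ge0// mulr_ge0.
move=> n N x a d U V Vq e S N0 a0 aU d0 V0 Vq0 VqE eC hVq hV.
have U0 : 0 <= U by apply: le_trans aU; exact: sumr_ge0.
have N1 : 1 <= N%:R :> R by rewrite ler1n.
have NR0 : 0 < N%:R :> R by lra.
have S0 r j : 0 <= S r j by apply: sumr_ge0 => i _; exact: powR_ge0.
(* Telescoping up to the index [k] where the [q]-th power sum is largest bounds this maximum in
   terms of itself. *)
have [k kn kmax] : exists2 k, (k <= n)%N & forall j, (j <= n)%N -> S q j <= S q k.
  have := @arg_maxP _ _ 'I_n.+1 ord0 xpredT (fun j => S q j) isT.
  case=> k _ kmax; exists k; first by rewrite -ltnS.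
  by move=> j jn; have := kmax (Ordinal (jn : (j < n.+1)%N)) isT.
pose M := S q k `^ q^-1.
have M0 : 0 <= M by exact: powR_ge0.
have MqE : M `^ q = S q k by rewrite /M -powRrM mulVf ?gt_eqF// powRr1.
have sq j : (j <= n)%N -> Num.sqrt (S (2 * (q - 1)) j) <= M `^ (q - 1).
  move=> jn.
  have e1 : 1 <= 2 * (q - 1) / q by rewrite ler_pdivlMr//; lra.
  have -> : S (2 * (q - 1)) j = \sum_i (`|x j i| `^ q) `^ (2 * (q - 1) / q).
    by apply: eq_bigr => i _; rewrite -powRrM; congr powR; field; rewrite gt_eqF.
  rewrite -powR12_sqrt; last by apply: sumr_ge0 => i _; exact: powR_ge0.
  apply: (@le_trans _ _ ((M `^ q) `^ (2 * (q - 1) / q) `^ 2^-1)).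
    rewrite ge0_ler_powR ?nnegrE ?powR_ge0//.
      by apply: sumr_ge0 => i _; exact: powR_ge0.
    apply: (le_trans (sum_powR_le e1 _)) => [i|]; first exact: powR_ge0.
    rewrite MqE ge0_ler_powR ?nnegrE ?S0//; last exact: kmax.
    exact: le_trans e1.
  rewrite -!powRrM le_eqVlt; apply/orP; left; apply/eqP; congr powR.
  by field; rewrite gt_eqF.
(* Every term free of [M] becomes a power of [B]: [N d^q <= B^q], [U <= B], and
   [sqrt N d^(q-1) <= B^(q-1)] because [N >= 1] and [1/2 <= (q-1)/q]. *)
pose B := N%:R `^ q^-1 * d + U.
have Nd0 : 0 <= N%:R `^ q^-1 * d by rewrite mulr_ge0 ?powR_ge0.
have B0 : 0 <= B by rewrite addr_ge0.
have NdB : N%:R `^ q^-1 * d <= B by rewrite lerDl.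
have UB : U <= B by rewrite lerDr.
have NdBq : N%:R * d `^ q <= B `^ q.
  have -> : N%:R * d `^ q = (N%:R `^ q^-1 * d) `^ q.
    by rewrite powRM ?powR_ge0// -powRrM mulVf ?gt_eqF// powRr1 ?ltW.
  by rewrite ge0_ler_powR ?nnegrE// ltW.
have sNdB : Num.sqrt N%:R * d `^ (q - 1) <= B `^ (q - 1).
  apply: (@le_trans _ _ ((N%:R `^ q^-1 * d) `^ (q - 1))).
    rewrite powRM ?powR_ge0// ler_wpM2r ?powR_ge0// -powRrM -powR12_sqrt ?ler0n//.
    rewrite ler_powR// mulrC ler_pdivlMr//; lra.
  by rewrite ge0_ler_powR ?nnegrE//; lra.
have MAB : M <= A * B.
  apply: (@self_bounded _ _ _ _ q) => //; first lra.
  rewrite MqE.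
  have -> : S q k = Vq k + N%:R * e k by rewrite VqE// subrK.
  apply: lerD.
    have Y0 : 0 <= B `^ (q - 1) + 2 * M `^ (q - 1).
      by rewrite addr_ge0 ?mulr_ge0 ?powR_ge0.
    apply: (@le_trans _ _ (c * U * (B `^ (q - 1) + 2 * M `^ (q - 1)))).
      apply: (le_trans (ler_norm _)); apply: (telescope_le c0 Y0 a0 aU Vq0) => //.
      move=> j jn; apply: (le_trans (hVq j jn)); rewrite ler_wpM2l ?mulr_ge0//.
      have := sq _ jn; have := sq _ (ltnW jn); lra.
    by rewrite ler_wpM2r// ler_wpM2l.
  apply: (@le_trans _ _ (N%:R * (C0 * d `^ q))).
    by rewrite ler_wpM2l ?eC// ltW.
  by rewrite mulrCA ler_wpM2l.
have sp j : (j <= n)%N -> Num.sqrt (S q j) <=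
    (2 * A) `^ (p - 1) * (Num.sqrt N%:R * d `^ (p - 1) + U `^ (p - 1)).
  move=> jn; rewrite -powR12_sqrt//.
  have p10 : 0 <= p - 1 by lra.
  apply: (@le_trans _ _ ((A * B) `^ (p - 1))).
    apply: (@le_trans _ _ ((M `^ q) `^ (2^-1))).
      by rewrite MqE ge0_ler_powR ?nnegrE// kmax.
    rewrite -powRrM (_ : q / 2 = p - 1); last by rewrite /q; field.
    by rewrite ge0_ler_powR ?nnegrE// mulr_ge0.
  rewrite powRM// [(2 * A) `^ _]powRM// [2 `^ _ * _]mulrC -mulrA.
  rewrite ler_wpM2l ?powR_ge0//.
  apply: (le_trans (powRD_le p10 Nd0 U0)).
  rewrite powRM ?powR_ge0// -powRrM (_ : q^-1 * (p - 1) = 2^-1) ?powR12_sqrt ?ler0n//.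
  rewrite /q; field; lra.
set s := Num.sqrt N%:R * d `^ (p - 1) in sp hV *.
set T := (2 * A) `^ (p - 1) in sp tA0 *.
have s0 : 0 <= s by rewrite mulr_ge0 ?sqrtr_ge0 ?powR_ge0.
have Up0 : 0 <= U `^ (p - 1) by exact: powR_ge0.
have p0 : 0 < p by lra.
have Y0 : 0 <= s + 2 * (T * (s + U `^ (p - 1))).
  by rewrite addr_ge0// !mulr_ge0// addr_ge0.
apply: (@le_trans _ _ (c * U * (s + 2 * (T * (s + U `^ (p - 1)))))).
  apply: (telescope_le c0 Y0 a0 aU V0) => //.
  move=> j jn; apply: (le_trans (hV j jn)); rewrite ler_wpM2l ?mulr_ge0//.
  have := sp _ jn; have := sp _ (ltnW jn); lra.
rewrite -(mulr_powRB1 U0 p0) -subr_ge0.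
set v := U `^ (p - 1) in Up0 *.
rewrite [leRHS](_ : _ = c * (U * v) + (U * s + U * v)); last by ring.
by apply: addr_ge0; [|apply: addr_ge0]; repeat apply: mulr_ge0 => //.
Qed.

End Chain.

Lemma pair_const_ge0 {R : realType} (r K : R) : 0 <= r -> 0 <= K -> 0 <= pair_const r K.
Proof.
move=> r0 K0; rewrite /pair_const /bernstein_const.
set c := _ + 6 * (K + 2).
have c0 : 0 <= c.
  rewrite /c; apply: addr_ge0; last by rewrite mulr_ge0// addr_ge0.
  apply: mulr_ge0; first by rewrite !mulr_ge0 ?powR_ge0.
  by rewrite !addr_ge0// ?mulr_ge0 ?powR_ge0 ?expR_ge0.
by rewrite addr_ge0// mulr_ge0// sqrtr_ge0.
Qed.

Lemma norm_powR_like {R : realType} (q : R) : 1 <= q ->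
  power_like q (fun x => `|x| `^ q).
Proof.
move=> q1; split => //.
- by apply: (measurableT_comp (measurable_powR q)); exact: normr_measurable.
- exact: norm_powR_lipschitz.
- by rewrite normr0 powR0// gt_eqF// (lt_le_trans ltr01 q1).
Qed.

(** [C] is produced before the probability spaces and the chain, so it depends on [p] and [K] only.
    The link estimates are hypotheses at one point [w], which leaves no probability in the
    statement. *)
Lemma path_bound {R : realType} (p K : R) : 2 <= p -> 0 <= K ->
  let q := 2 * (p - 1) in
  exists2 C, 0 < C & forall (dO dT : measure_display)
    (Omega : measurableType dO) (T : measurableType dT) (mu : probability Omega R)
    (N : nat) (X : 'I_N -> {mfun T >-> Omega}) (phi : R -> R) (d U : R) (n : nat)
    (y : nat -> Omega -> R) (del t : nat -> R) (w : T),
  power_like p phi -> (0 < N)%N -> 0 < d -> y 0%N = cst 0 ->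
  (forall j, (j <= n)%N -> measurable_fun setT (y j)) ->
  (forall j, (j <= n)%N -> orlicz_le mu d (y j)) ->
  (forall j, 0 <= del j) -> \sum_(j < n) Num.sqrt (t j) * del j <= U ->
  (forall j, (j < n)%N ->
    pair_bound mu X (y j.+1) (y j) d (del j) (t j) (pair_const p K) p phi w /\
    pair_bound mu X (y j.+1) (y j) d (del j) (t j) (pair_const q K) q
      (fun x => `|x| `^ q) w) ->
  `|deviation mu X phi (y n) w| <= C * (U * (Num.sqrt N%:R * d `^ (p - 1)) + U `^ p).
Proof.
move=> p2 K0 q.
have q2 : 2 <= q by rewrite /q; lra.
have p0 : 0 <= p by lra.
have q0 : 0 <= q by lra.
have cp0 := pair_const_ge0 p0 K0; have cq0 := pair_const_ge0 q0 K0.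
pose c := pair_const p K + pair_const q K.
have c0 : 0 <= c by exact: addr_ge0.
have C00 : 0 <= (q / 2) `^ (q / 2) * 2 :> R by rewrite mulr_ge0 ?powR_ge0.
have [C C0 H] := chain_bound p2 c0 C00.
exists C => // dO dT Omega T mu N X phi d U n y del t w plike N0 d0 y0 my yd del0 tU hy.
have a0 j : 0 <= Num.sqrt (t j) * del j by rewrite mulr_ge0 ?sqrtr_ge0.
have [_ _ _ phi0] := plike.
have dev0 (psi : R -> R) : psi 0 = 0 -> deviation mu X psi (y 0%N) w = 0.
  move=> psi0; rewrite /deviation y0 /= psi0 big1//.
  rewrite (_ : Rintegral _ _ _ = 0) ?mulr0 ?subr0//.
  by rewrite /Rintegral integral0_eq// => x _; rewrite psi0.
have qq1 : 1 <= q by lra.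
have [_ _ _ q00] := norm_powR_like qq1.
pose e j := \int[mu]_x `|y j x| `^ q.
apply: (H n N (fun j i => y j (X i w)) (fun j => Num.sqrt (t j) * del j) d U
  (fun j => deviation mu X phi (y j) w)
  (fun j => deviation mu X (fun x => `|x| `^ q) (y j) w) e) => //.
- exact: ltW.
- exact: dev0.
- exact: dev0.
- move=> j jn; have q00' : 0 < q by lra.
  have := orlicz_moment q00' (my j jn) (yd j jn).
  set I := (integral _ _ _) => Iq.
  have I0 : (0 <= I)%E by apply: integral_ge0 => x _; rewrite lee_fin powR_ge0.
  rewrite -lee_fin /e /Rintegral fineK//.
  by rewrite ge0_fin_numE// (le_lt_trans Iq)// ltry.
- move=> j jn; have [_ /le_trans] := hy j jn; apply.
  rewrite ler_wpM2r//.
    by rewrite !addr_ge0 ?mulr_ge0 ?sqrtr_ge0 ?powR_ge0.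
  by rewrite ler_wpM2r// /c lerDr.
- move=> j jn; have [/le_trans + _] := hy j jn; apply.
  rewrite ler_wpM2r//.
    by rewrite !addr_ge0 ?mulr_ge0 ?sqrtr_ge0 ?powR_ge0.
  by rewrite ler_wpM2r// /c lerDl.
Qed.

(** * From the [psi_2] norm to explicit constants *)

Section Psi2.
Context {R : realType} {dO : measure_display} {Omega : measurableType dO}.
Variable mu : probability Omega R.

Lemma orlicz_psi2 (c : R) (f : Omega -> R) : measurable_fun setT f ->
  (psi2_norm mu f < c%:E)%E -> orlicz_le mu c f.
Proof.
move=> mf /ereal_inf_lt[_ [c1 [c10 fc1] <-]]; rewrite lte_fin => c1c.
have c0 : 0 < c by exact: lt_trans c1c.
apply: (orlicz_le_trans mf mf c0 _ (conj c10 fc1)) => x.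
by rewrite ler_wpM2l// lef_pV2 ?posrE// ltW.
Qed.

Lemma psi2_orlicz (c : R) (f : Omega -> R) :
  orlicz_le mu c f -> (psi2_norm mu f <= c%:E)%E.
Proof. by move=> fc; apply: ereal_inf_lbound; exists c. Qed.

Lemma psi2_norm_ge0 (f : Omega -> R) : (0 <= psi2_norm mu f)%E.
Proof. by apply: le_ereal_inf_tmp => _ [c [c0 _] <-]; rewrite lee_fin ltW. Qed.

Lemma dist_to_set_psi2_ge0 (f : Omega -> R) (A : set (Omega -> R)) :
  (0 <= dist_to_set (psi2_dist mu) f A)%E.
Proof. by apply: le_ereal_inf_tmp => _ [g _ <-]; exact: psi2_norm_ge0. Qed.

(** [del] precedes [c] in the quantifiers: one radius is attached to a pair of functions, and it
    must be nearly optimal for every [f] whose chain uses that pair. The slack [eta] is there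
    because the infimum may not be attained. *)
Lemma near_optimal_orlicz (f : Omega -> R) (eta : R) : 0 < eta -> exists del : R,
  forall c, measurable_fun setT f -> orlicz_le mu c f ->
  orlicz_le mu del f /\ del <= c + eta.
Proof.
move=> eta0; exists (fine (psi2_norm mu f) + eta) => c mf fc.
have h := psi2_orlicz fc.
have fn : psi2_norm mu f \is a fin_num.
  by rewrite ge0_fin_numE ?psi2_norm_ge0// (le_lt_trans h)// ltry.
split; first by apply: orlicz_psi2 => //; rewrite EFinD fineK// lteDl// lte_fin.
by rewrite lerD2r -lee_fin fineK.
Qed.

End Psi2.

(** * Union bounds *)

Section BadEvents.
Context {R : realType} {dT : measure_display} {T : measurableType dT}.
Variable P : probability T R.

(** The failure of [Q] is covered by a measurable set, so the union bound never speaks of the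
    measurability of [Q]. *)
Lemma bad_event_finite (n : nat) (Q : nat -> T -> Prop) (eps : R) :
  (forall k, (k < n)%N -> exists B : set T, [/\ measurable B, (P B <= eps%:E)%E &
     forall w, ~ B w -> Q k w]) ->
  exists B : set T, [/\ measurable B, (P B <= (n%:R * eps)%:E)%E &
     forall w, ~ B w -> forall k, (k < n)%N -> Q k w].
Proof.
elim: n => [_|n IH H].
  by exists set0; split => //; rewrite measure0 mul0r.
have [|B [mB PB HB]] := IH; first by move=> k kn; exact: H (ltnW kn).
have [B' [mB' PB' HB']] := H n (ltnSn n).
exists (B `|` B'); split; first exact: measurableU.
  apply: (le_trans (measureU2 _ mB mB')).
  by rewrite -natr1 mulrDl mul1r EFinD; exact: leeD.
move=> w /not_orP[wB wB'] k; rewrite ltnS leq_eqVlt => /predU1P[->|kn]; first exact: HB'.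
exact: HB.
Qed.

Lemma bad_event_countable (Q : nat -> T -> Prop) (eps : R) : 0 <= eps ->
  (forall k, exists B : set T, [/\ measurable B, (P B <= (eps / (2 ^ k.+1)%:R)%:E)%E &
     forall w, ~ B w -> Q k w]) ->
  exists B : set T, [/\ measurable B, (P B <= eps%:E)%E &
     forall w, ~ B w -> forall k, Q k w].
Proof.
move=> eps0 /choice[B HB].
have mB k : measurable (B k) by case: (HB k).
exists (\bigcup_k B k); split.
- exact: bigcupT_measurable.
- apply: (le_trans (generalized_Boole_inequality _ mB _)).
    exact: bigcupT_measurable.
  apply: (@le_trans _ _ (\big[+%E/0%R]_(0 <= i <oo) (0 + (eps / (2 ^ i.+1)%:R)%:E))%E).
    apply: lee_nneseries => // i _; rewrite add0e; by case: (HB i).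
  apply: (le_trans (epsilon_trick (A := fun=> 0%E) xpredT _ eps0)) => //.
  by rewrite eseries0// add0e.
move=> w wB k; have [_ _ h] := HB k; apply: h => wk; apply: wB; by exists k.
Qed.

End BadEvents.

Lemma card_le_enum {U : Type} (A : set U) (n : nat) : A !=set0 -> (A #<= `I_n)%card ->
  exists e : nat -> U, (forall k, (k < n)%N -> A (e k)) /\
    forall x, A x -> exists2 k, (k < n)%N & e k = x.
Proof.
move=> [x0 Ax0] /pfcard_geP[A0|[e]]; first by move: Ax0; rewrite A0.
exists e; split; first by move=> k kn; exact: (@funS _ _ `I_n A e).
by move=> x /(@surj _ _ `I_n A e)[k kn <-]; exists k.
Qed.

(** * Cardinality of a level against the exponential tail *)

Section LevelBound.
Context {R : realType}.

Lemma natr_exp2_le (m : nat) : (2 ^ m)%:R <= expR m%:R :> R.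
Proof.
rewrite natrX -[m%:R]mulr1 expRM_natl lerXn2r ?nnegrE ?expR_ge0//.
by have := expR_ge1Dx (1 : R); rewrite -[1 + 1]/(2 : R).
Qed.

(* 2^(2^s) and 2^(2^s+2^(s+1)) count the pairs of level s; the factor 24 in the
   exponent absorbs these counts and leaves a summable remainder. *)
Lemma level_probability (u : R) (s0 j s : nat) : 1 <= u -> s = (s0 + j)%N ->
  ((2 ^ (2 ^ s))%:R + (2 ^ (2 ^ s))%:R * (2 ^ (2 ^ s.+1))%:R) *
    (5 * expR (- (24 * (u ^+ 2 * (2 ^ s)%:R)))) <=
  expR (- (u ^+ 2 * (2 ^ s0)%:R)) / (2 ^ j.+1)%:R :> R.
Proof.
move=> u1 sE; set x : R := (2 ^ s)%:R.
have u2 : 1 <= u ^+ 2 by rewrite expr_ge1//; lra.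
have x1 : 1 <= x by rewrite ler1n expn_gt0.
have xs0 : (2 ^ s0)%:R <= x by rewrite ler_nat leq_exp2l// sE leq_addr.
have xj : j.+1%:R <= x.
  rewrite ler_nat (leq_trans (ltn_expl j (ltnSn 1)))// leq_exp2l//.
  by rewrite sE leq_addl.
have p1 : (2 ^ (2 ^ s))%:R <= expR x := natr_exp2_le (2 ^ s).
have p2 : (2 ^ (2 ^ s.+1))%:R <= expR (2 * x).
  by have := natr_exp2_le (2 ^ s.+1); rewrite {2}expnS natrM.
have ten : 10 <= expR 10 :> R by have := expR_ge1Dx (10 : R); lra.
rewrite ler_pdivlMr ?ltr0n ?expn_gt0//.
have p3 : (2 ^ j.+1)%:R <= expR x.
  by apply: (le_trans (natr_exp2_le _)); rewrite ler_expR.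
set a := (2 ^ 2 ^ s)%:R in p1 *; set b := (2 ^ 2 ^ s.+1)%:R in p2 *.
set c := (2 ^ j.+1)%:R in p3 *.
have a0 : 0 <= a by []. have b0 : 0 <= b by []. have c0 : 0 <= c by [].
have q1 : a + a * b <= 2 * (expR x * expR (2 * x)).
  have r1 : a * b <= expR x * expR (2 * x) by exact: ler_pM.
  have r2 : a <= expR x * expR (2 * x).
    rewrite -[leLHS]mulr1; apply: ler_pM => //.
    by rewrite -[leLHS]expR0 ler_expR; lra.
  lra.
have e0 := expR_ge0 (- (24 * (u ^+ 2 * x))).
apply: (@le_trans _ _ ((2 * (expR x * expR (2 * x))) *
    (5 * expR (- (24 * (u ^+ 2 * x)))) * expR x)).
  by apply: ler_pM => //; rewrite ?ler_wpM2r ?mulr_ge0 ?addr_ge0// mulr_ge0.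
apply: (@le_trans _ _ (expR 10 * (expR x * expR (2 * x) *
    expR (- (24 * (u ^+ 2 * x))) * expR x))).
  rewrite [leLHS](_ : _ = 10 * (expR x * expR (2 * x) *
    expR (- (24 * (u ^+ 2 * x))) * expR x)); last by ring.
  by rewrite ler_wpM2r// !mulr_ge0 ?expR_ge0.
(* Here [10 = 2 5] was absorbed into [exp 10]. As [x >= 1] and [u >= 1],
   [10 + 4x <= 14x <= 23 u^2 x], which leaves [- u^2 x <= - u^2 2^s0]. *)
rewrite -!expRD ler_expR.
have k1 : u ^+ 2 * (2 ^ s0)%:R <= u ^+ 2 * x by rewrite ler_wpM2l//; lra.
have k2 : x <= u ^+ 2 * x by rewrite ler_peMl//; lra.
lra.
Qed.

End LevelBound.

(** * The good event *)

Section GoodEvent.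
Context {R : realType} {dO dT : measure_display}.
Context {Omega : measurableType dO} {T : measurableType dT}.
Variables (mu : probability Omega R) (P : probability T R).
Variables (N : nat) (X : 'I_N -> {mfun T >-> Omega}) (p : R) (phi : R -> R).
Variables (u d : R) (s0 : nat) (Fs : nat -> set (Omega -> R)).
Variable del : nat -> (Omega -> R) -> (Omega -> R) -> R.
Hypotheses (N0 : (0 < N)%N) (iidX : iid_with_law P mu X).
Hypotheses (p2 : 2 <= p) (phi_like : power_like p phi) (u1 : 1 <= u).
Hypothesis mFs : forall s f, Fs s f -> measurable_fun setT f.
Hypothesis Fsd : forall s f, Fs s f -> orlicz_le mu d f.
Hypothesis Fs0 : forall s, Fs s !=set0.
Hypothesis card_Fs : forall s, (Fs s #<= `I_(2 ^ (2 ^ s)))%card.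
Hypothesis Fsdel : forall s g h, Fs s g -> Fs s.+1 h -> orlicz_le mu (del s g h) (h \- g).

Let q : R := 2 * (p - 1).
Let q1 : 1 <= q. Proof. by have := p2; rewrite /q; lra. Qed.

Let d0 : 0 < d.
Proof. by have [f /Fsd[]] := Fs0 0%N. Qed.

Let level (s : nat) : R := u ^+ 2 * (2 ^ s)%:R.

Let level_gt0 s : 0 < level s.
Proof.
have u0 : 0 < u := lt_le_trans ltr01 u1.
by rewrite mulr_gt0// ?exprn_gt0// ltr0n expn_gt0.
Qed.

Definition pair_good (s : nat) (g h : Omega -> R) (dl : R) (w : T) : Prop :=
  pair_bound mu X g h d dl (u ^+ 2 * (2 ^ s)%:R) (pair_const p 24) p phi w /\
  pair_bound mu X g h d dl (u ^+ 2 * (2 ^ s)%:R) (pair_const (2 * (p - 1)) 24)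
    (2 * (p - 1)) (fun x => `|x| `^ (2 * (p - 1))) w.

Lemma pair_good_probability s g h dl : measurable_fun setT g -> measurable_fun setT h ->
  orlicz_le mu d g -> orlicz_le mu d h -> orlicz_le mu dl (g \- h) ->
  exists B : set T, [/\ measurable B, (P B <= (5 * expR (- (24 * level s)))%:E)%E &
    forall w, ~ B w -> pair_good s g h dl w].
Proof.
move=> mg mh gd hd ghd.
by apply: pair_deviation => //; exact: norm_powR_like.
Qed.

Let orlicz_cst0 : orlicz_le mu d (cst 0).
Proof.
split => //; rewrite (_ : (fun _ => _) = cst 1%:E).
  by rewrite integral_probability_cst lee_fin; lra.
by apply/funext => x; rewrite /= normr0 expr0n mul0r expR0.
Qed.

(** All pairs of elements of the two finite sets are covered, not only pairs of projections of one
    function, so the event is the same for every [f]. The pairs with 0 provide the first link of a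
    chain entering at level [s]. *)
Lemma level_good s : exists B : set T, [/\ measurable B,
  (P B <= (((2 ^ (2 ^ s))%:R + (2 ^ (2 ^ s))%:R * (2 ^ (2 ^ s.+1))%:R) *
    (5 * expR (- (24 * level s))))%:E)%E &
  forall w, ~ B w -> (forall g, Fs s g -> pair_good s g (cst 0) d w) /\
    forall g h, Fs s g -> Fs s.+1 h -> pair_good s h g (del s g h) w].
Proof.
have [e [eF Fe]] := card_le_enum (Fs0 s) (card_Fs s).
have [e' [eF' Fe']] := card_le_enum (Fs0 s.+1) (card_Fs s.+1).
have [k kl|B1 [mB1 PB1 HB1]] := @bad_event_finite _ _ _ P (2 ^ (2 ^ s))
    (fun k => pair_good s (e k) (cst 0) d) (5 * expR (- (24 * level s))).
  have Fk := eF k kl.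
  apply: pair_good_probability => //; [exact: mFs Fk|exact: Fsd Fk|].
  apply: (orlicz_le_trans _ _ d0 _ (Fsd Fk)).
  - by apply: measurable_funB => //; exact: mFs Fk.
  - exact: mFs Fk.
  - by move=> x; rewrite /= subr0.
have [k kl|B2 [mB2 PB2 HB2]] := @bad_event_finite _ _ _ P (2 ^ (2 ^ s))
    (fun k w => forall l, (l < 2 ^ (2 ^ s.+1))%N ->
        pair_good s (e' l) (e k) (del s (e k) (e' l)) w)
    ((2 ^ (2 ^ s.+1))%:R * (5 * expR (- (24 * level s)))).
  apply: bad_event_finite => l ll.
  have Fk := eF k kl; have Fl := eF' l ll.
  apply: pair_good_probability.
  - exact: mFs Fl.
  - exact: mFs Fk.
  - exact: Fsd Fl.
  - exact: Fsd Fk.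
  - exact: Fsdel.
exists (B1 `|` B2); split; first exact: measurableU.
  apply: (le_trans (measureU2 _ mB1 mB2)).
  by rewrite mulrDl -mulrA EFinD; exact: leeD.
move=> w /not_orP[w1 w2]; split.
  by move=> g /Fe[k kl <-]; exact: HB1.
by move=> g h /Fe[k kl <-] /Fe'[l ll <-]; exact: HB2.
Qed.

Lemma chain_good : exists B : set T, [/\ measurable B,
  (P B <= (expR (- (u ^+ 2 * (2 ^ s0)%:R)))%:E)%E &
  forall w, ~ B w -> (forall s g, (s0 <= s)%N -> Fs s g -> pair_good s g (cst 0) d w) /\
    forall s g h, (s0 <= s)%N -> Fs s g -> Fs s.+1 h -> pair_good s h g (del s g h) w].
Proof.
pose Q j w := (forall g, Fs (s0 + j)%N g -> pair_good (s0 + j) g (cst 0) d w) /\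
    forall g h, Fs (s0 + j)%N g -> Fs (s0 + j).+1 h ->
      pair_good (s0 + j) h g (del (s0 + j)%N g h) w.
have [|k|B [mB PB HB]] := @bad_event_countable _ _ _ P Q (expR (- (u ^+ 2 * (2 ^ s0)%:R))).
- exact: expR_ge0.
- have [B [mB PB HB]] := level_good (s0 + k)%N.
  exists B; split => //; apply: (le_trans PB); rewrite lee_fin.
  exact: level_probability.
exists B; split => // w wB; split.
  by move=> s g ss Fg; have := HB w wB (s - s0)%N; rewrite /Q subnKC// => -[+ _]; exact.
move=> s g h ss Fg Fh; have := HB w wB (s - s0)%N.
by rewrite /Q subnKC// => -[_ +]; exact.
Qed.

(** * The chain of a fixed function: [G0], [G], [Geta] bound its first link, its projection radii
    and the slack *)

Variables (C G0 G Geta : R).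
Hypothesis pathC : forall (d U : R) (n : nat)
    (y : nat -> Omega -> R) (del t : nat -> R) (w : T),
  0 < d -> y 0%N = cst 0 ->
  (forall j, (j <= n)%N -> measurable_fun setT (y j)) ->
  (forall j, (j <= n)%N -> orlicz_le mu d (y j)) ->
  (forall j, 0 <= del j) -> \sum_(j < n) Num.sqrt (t j) * del j <= U ->
  (forall j, (j < n)%N ->
    pair_bound mu X (y j.+1) (y j) d (del j) (t j) (pair_const p 24) p phi w /\
    pair_bound mu X (y j.+1) (y j) d (del j) (t j) (pair_const q 24) q
      (fun x => `|x| `^ q) w) ->
  `|deviation mu X phi (y n) w| <= C * (U * (Num.sqrt N%:R * d `^ (p - 1)) + U `^ p).

Variable eta : nat -> R.
Hypothesis eta0 : forall s, 0 <= eta s.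
Hypothesis etaG : forall n, \sum_(0 <= s < n) 2 `^ (s%:R / 2) * eta s <= Geta.
Hypothesis del_opt : forall s g h c, Fs s g -> Fs s.+1 h ->
  orlicz_le mu c (h \- g) -> del s g h <= c + eta s.
Hypothesis start : 2 `^ (s0%:R / 2) * d <= G0.

Lemma sqrt_level s : Num.sqrt (level s) = u * 2 `^ (s%:R / 2).
Proof.
have u0 : 0 <= u := le_trans ler01 u1.
rewrite sqrtrM ?sqr_ge0// sqrtr_sqr ger0_norm//.
by rewrite natrX -powR_mulrn// -powR12_sqrt ?powR_ge0// -powRrM.
Qed.

Variables (f : Omega -> R) (pr : nat -> Omega -> R) (c : nat -> R).
Hypotheses (mf : measurable_fun setT f) (fd : orlicz_le mu d f).
Hypothesis prF : forall s, Fs s (pr s).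
Hypothesis prc : forall s, orlicz_le mu (c s) (f \- pr s).
Hypothesis cG : forall n, \sum_(0 <= s < n) 2 `^ (s%:R / 2) * c s <= G.

Let c0 s : 0 < c s. Proof. by case: (prc s). Qed.

Lemma del_le s : del s (pr s) (pr s.+1) <= 2 * (c s + c s.+1) + eta s.
Proof.
apply: del_opt => //.
have mpr k : measurable_fun setT (pr k) by exact: mFs (prF k).
have m1 : measurable_fun setT (f \- pr s) by exact: measurable_funB.
have m2 : measurable_fun setT (f \- pr s.+1) by exact: measurable_funB.
have m2' : measurable_fun setT (pr s.+1 \- f) by exact: measurable_funB.
have o2 : orlicz_le mu (c s.+1) (pr s.+1 \- f).
  apply: (orlicz_le_trans m2' m2 (c0 _) _ (prc s.+1)) => x /=.
  by rewrite distrC.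
have := orlicz_leD m1 m2' (prc s) o2.
rewrite (_ : (f \- pr s) \+ (pr s.+1 \- f) = pr s.+1 \- pr s)//.
by apply/funext => x /=; ring.
Qed.

(** A chain of [m + 2] links: 0, then [pr s0] to [pr (s0 + m)] at indices 1 to [m + 1], then [f] at
    index [m + 2]. Links 0 and 1 both carry the level [s0]; the last link has radius [c (s0 + m)]
    and level [s0 + m]. *)
Let path_y m j : Omega -> R :=
  if j is j'.+1 then (if (j' <= m)%N then pr (s0 + j')%N else f) else cst 0.
Let path_del m j : R :=
  if j is j'.+1 then
    (if (j' < m)%N then del (s0 + j')%N (pr (s0 + j')%N) (pr (s0 + j').+1)
     else c (s0 + m)%N)
  else d.
Let path_t j : R := if j is j'.+1 then level (s0 + j') else level s0.

Let w (s : nat) : R := 2 `^ (s%:R / 2).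

Let w_ge0 s : 0 <= w s. Proof. exact: powR_ge0. Qed.

Let shifted_sum_le (F : nat -> R) (k m : nat) (B : R) : (forall s, 0 <= F s) ->
  (forall n, \sum_(0 <= s < n) F s <= B) -> \sum_(0 <= i < m) F (k + i)%N <= B.
Proof.
move=> F0 FB; apply: le_trans (FB (k + m)%N).
rewrite (@big_cat_nat _ _ _ k 0 (k + m))//=; last exact: leq_addr.
rewrite -{3}[k]add0n big_addn addnC addnK.
under eq_bigr do rewrite addnC.
by rewrite lerDr sumr_ge0.
Qed.

(** Of the [5 G], [4 G] come from [del_le], twice for each of the two projections bounding an
    intermediate link, and one [G] from the closing link. The radius [c s.+1] is paired with the
    smaller weight of level [s], which only helps. *)
Lemma path_weight m :
  \sum_(j < m.+2) Num.sqrt (path_t j) * path_del m j <= u * (G0 + 5 * G + Geta).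
Proof.
have u0 : 0 <= u := le_trans ler01 u1.
rewrite -(big_mkord xpredT (fun j => Num.sqrt (path_t j) * path_del m j)).
rewrite big_nat_recl// big_nat_recr//= ltnn !sqrt_level -!/(w _).
have wc0 s : 0 <= w s * c s by rewrite mulr_ge0// ltW.
have b1 : u * w s0 * d <= u * G0 by rewrite -mulrA ler_wpM2l.
have b3 : u * w (s0 + m) * c (s0 + m)%N <= u * G.
  rewrite -mulrA ler_wpM2l//; apply: le_trans (cG (s0 + m).+1).
  by rewrite big_nat_recr//= lerDr; apply: sumr_ge0 => s _; exact: wc0.
have b2 : \sum_(0 <= i < m) Num.sqrt (level (s0 + i)) *
     (if (i < m)%N then del (s0 + i) (pr (s0 + i)%N) (pr (s0 + i).+1) else c (s0 + m)%N)
   <= u * (4 * G + Geta).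
  apply: (@le_trans _ _ (u * (2 * \sum_(0 <= i < m) w (s0 + i) * c (s0 + i)%N +
     2 * \sum_(0 <= i < m) w (s0.+1 + i) * c (s0.+1 + i)%N +
     \sum_(0 <= i < m) w (s0 + i) * eta (s0 + i)%N))).
    rewrite !mulr_sumr -!big_split/= mulr_sumr.
    apply: ler_sum_nat => i /andP[_ im]; rewrite im sqrt_level -/(w _).
    rewrite -mulrA ler_wpM2l//.
    apply: (le_trans (ler_wpM2l (w_ge0 _) (del_le _))).
    have ww : w (s0 + i) * c (s0 + i).+1 <= w (s0.+1 + i) * c (s0.+1 + i)%N.
      rewrite addSn ler_wpM2r ?(ltW (c0 _))// /w ler_powR ?ler1n//.
      by rewrite ler_wpM2r// ler_nat.
    lra.
  rewrite ler_wpM2l//.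
  have h1 := @shifted_sum_le (fun s => w s * c s) s0 m G wc0 cG.
  have h2 := @shifted_sum_le (fun s => w s * c s) s0.+1 m G wc0 cG.
  have h3 := @shifted_sum_le (fun s => w s * eta s) s0 m Geta
    (fun s => mulr_ge0 (w_ge0 s) (eta0 s)) etaG.
  lra.
lra.
Qed.

(* For a fixed f the chain is closed by the pair (f, pr (s0 + m)); the event where
   this pair is bad has probability tending to 0 with m, so that no limit of
   pr s along s, and no density of the chain, is needed. *)
Lemma deviation_ae (Bad : set T) : measurable Bad ->
  (forall w, ~ Bad w -> (forall s g, (s0 <= s)%N -> Fs s g -> pair_good s g (cst 0) d w) /\
    forall s g h, (s0 <= s)%N -> Fs s g -> Fs s.+1 h -> pair_good s h g (del s g h) w) ->
  let U := u * (G0 + 5 * G + Geta) in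
  {ae P, forall w, ~ Bad w -> `|deviation mu X phi f w| <=
     C * (U * (Num.sqrt N%:R * d `^ (p - 1)) + U `^ p)}.
Proof.
move=> mBad good U.
set bound := C * _.
have [_ mphi _ _] := phi_like.
have mdev : measurable_fun setT (deviation mu X phi f).
  apply: measurable_funB => //; apply: measurable_sum => i.
  by apply: measurableT_comp => //; exact: measurableT_comp.
have mset : measurable [set w | bound < `|deviation mu X phi f w|].
  rewrite (_ : [set _ | _] = ~` [set w | `|deviation mu X phi f w| <= bound]).
    by apply: measurableC; apply: measurable_set_le => //; exact: measurableT_comp.
  by apply/seteqP; split => x /=; rewrite ltNge => /negP.
pose A := [set w | bound < `|deviation mu X phi f w|] `\` Bad.
have mA : measurable A by exact: measurableD.
have mpr k : measurable_fun setT (pr k) by exact: mFs (prF k).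
have PA m : (P A <= (5 * expR (- (24 * level (s0 + m))))%:E)%E.
  have [B [mB PB HB]] := pair_good_probability (s0 + m)%N mf (mpr (s0 + m)%N) fd
    (Fsd (prF (s0 + m)%N)) (prc (s0 + m)%N).
  apply: le_trans PB; apply: le_measure; rewrite ?inE// => v [/= bv nBv].
  apply: contrapT => nB; have [good0 good1] := good v nBv.
  move: bv; apply/negP; rewrite -leNgt.
  have -> : f = path_y m m.+2 by rewrite /path_y ltnn.
  apply: (pathC (del := path_del m) (t := path_t)) => //.
  - case=> [|j] //= jm; case: ifP => // _.
  - case=> [|j] //= jm; case: ifP => // _; exact: Fsd.
  - case=> [|j] /=; first exact: ltW.
    case: ifP => _; last exact: ltW.
    by apply/ltW; case: (Fsdel (prF (s0 + j)) (prF (s0 + j).+1)).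
  - exact: path_weight.
  - case=> [|j] /=; first by move=> _; rewrite addn0; exact: good0 (leqnn _) (prF _).
    rewrite !ltnS leq_eqVlt => /predU1P[->|jm].
      by rewrite ltnn eqxx; exact: HB.
    rewrite jm orbT addnS; apply: good1 => //; exact: leq_addr.
have PA0 : P A = 0%E.
  apply/eqP; rewrite eq_le measure_ge0 andbT; apply/lee_addgt0Pr => e e0.
  rewrite add0e; have [m me] : exists m : nat, 5 / e < m%:R.
    by exists (Num.truncn (5 / e)).+1; exact: truncnS_gt.
  apply: (le_trans (PA m)); rewrite lee_fin expRN.
  rewrite ler_pdivrMr ?expR_gt0//.
  have me' : 5 < m%:R * e by rewrite -ltr_pdivrMr.
  have k1 : m%:R <= expR (24 * level (s0 + m)).
    apply: (@le_trans _ _ (24 * level (s0 + m))); last first.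
      by apply: le_trans (expR_ge1Dx _); rewrite lerDr.
    have u2 : 1 <= u ^+ 2 by rewrite expr_ge1//; exact: le_trans u1.
    have x1 : m%:R <= (2 ^ (s0 + m))%:R :> R.
      rewrite ler_nat (leq_trans (ltnW (ltn_expl m (ltnSn 1))))// leq_exp2l//.
      exact: leq_addl.
    rewrite /level; set x := (2 ^ _)%:R in x1 *.
    have x0 : 0 <= x by [].
    have : x <= u ^+ 2 * x by rewrite ler_peMl.
    lra.
  apply/ltW/(lt_le_trans me'); rewrite mulrC ler_wpM2l// ltW//.
exists A; split => // v /= /not_implyP[nB /negP]; rewrite -ltNge => h.
by split.
Qed.

End GoodEvent.

(** * Admissible sequences *)

(** For an integer exponent [phi] is the signed power; otherwise it is [|x|^p], which represents
    [rpower] on nonnegative values. *)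
Lemma rpower_like {R : realType} (p : R) : 2 <= p ->
  exists2 phi : R -> R, power_like p phi &
    (forall x, p \is a Num.nat \/ 0 <= x -> rpower p x = phi x).
Proof.
move=> p2; have p1 : 1 <= p by lra.
have [pn|pn] := boolP (p \is a Num.nat); last first.
  exists (fun x => `|x| `^ p); first exact: norm_powR_like.
  by move=> x [//|x0]; rewrite /rpower (negbTE pn) ger0_norm.
exists (fun x => x ^+ Num.truncn p); last by move=> x _; rewrite /rpower pn.
have [n pE] := natrP pn.
have -> : Num.truncn p = n by rewrite pE natrK.
have [m nE] : exists m, n = m.+1.
  by case: n pE => [p0|m _]; [move: p2; rewrite p0; lra|exists m].
rewrite pE nE; split.
- by rewrite ler1n.
- exact: measurable_funX.
- exact: exprn_lipschitz.
- by rewrite expr0n.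
Qed.

Section Projections.
Context {R : realType} {dO : measure_display} {Omega : measurableType dO}.
Variables (mu : probability Omega R) (F : set (Omega -> R)).
Hypothesis mF : forall f, F f -> measurable_fun setT f.
Hypothesis F0 : F !=set0.

Let w (s : nat) : R := 2 `^ (s%:R / 2).

Let w_gt0 s : 0 < w s. Proof. by rewrite powR_gt0. Qed.

Let term_ge0 (Fs : nat -> set (Omega -> R)) f s :
  (0 <= (w s)%:E * dist_to_set (psi2_dist mu) f (Fs s))%E.
Proof. by rewrite mule_ge0 ?lee_fin ?(ltW (w_gt0 s))// dist_to_set_psi2_ge0. Qed.

Lemma talagrand_gamma_ge0 : (0 <= talagrand_gamma (psi2_dist mu) F)%E.
Proof.
have [f Ff] := F0.
apply: le_ereal_inf_tmp => _ [Fs _ <-].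
apply: le_ereal_sup_tmp; eexists; first by exists f.
by apply: nneseries_ge0 => s _ _; exact: term_ge0.
Qed.

Lemma near_optimal_admissible (g : R) : (talagrand_gamma (psi2_dist mu) F < g%:E)%E ->
  exists2 Fs, admissible (psi2_dist mu) F Fs &
    forall f, F f -> (\sum_(0 <= s <oo)
      ((w s)%:E * dist_to_set (psi2_dist mu) f (Fs s)) <= g%:E)%E.
Proof.
move=> /ereal_inf_lt[_ [Fs aFs <-] supg]; exists Fs => // f Ff.
by apply: le_trans (ltW supg); apply: ereal_sup_ubound; exists f.
Qed.

(** Passing from a distance to an explicit constant needs a strict inequality, hence the radius
    [D s + eta s]. The weighted slack is kept as a separate sum, to be made small by the choice of
    [eta]. *)
Lemma projections (Fs : nat -> set (Omega -> R)) (g : R) (eta : nat -> R) f :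
  admissible (psi2_dist mu) F Fs -> (forall s, 0 < eta s) -> F f ->
  (\sum_(0 <= s <oo) ((w s)%:E * dist_to_set (psi2_dist mu) f (Fs s)) <= g%:E)%E ->
  exists (pr : nat -> Omega -> R) (c : nat -> R),
    [/\ forall s, Fs s (pr s), forall s, orlicz_le mu (c s) (f \- pr s) &
     forall n, \sum_(0 <= s < n) w s * c s <= g + \sum_(0 <= s < n) w s * eta s].
Proof.
move=> [FsF _ _ _ _] eta0 Ff fg.
pose D s := dist_to_set (psi2_dist mu) f (Fs s).
have D0 s : (0 <= D s)%E by exact: dist_to_set_psi2_ge0.
have partial n : (\sum_(0 <= s < n) (w s)%:E * D s <= g%:E)%E.
  by apply: le_trans fg; apply: nneseries_lim_ge => s _ _; exact: term_ge0.
(* An infinite distance at a single level would make a partial sum infinite, against the bound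
   [g]. *)
have Dfin s : D s \is a fin_num.
  rewrite ge0_fin_numE// ltNge leye_eq; apply/negP => /eqP Dy.
  have := partial s.+1; rewrite big_nat_recr//= Dy gt0_muley ?lte_fin//.
  rewrite addey ?leye_eq//.
  by rewrite gt_eqF// (lt_le_trans (ltNyr 0))// sume_ge0// => i _; exact: term_ge0.
have /choice[pr Hpr] : forall s, exists h, Fs s h /\
    orlicz_le mu (fine (D s) + eta s) (f \- h).
  move=> s; have : (D s < (fine (D s) + eta s)%:E)%E.
    by rewrite EFinD fineK// lteDl// lte_fin.
  move=> /ereal_inf_lt[_ [h Fh <-] fh]; exists h; split => //.
  apply: orlicz_psi2 => //; apply: measurable_funB; apply: mF => //.
  exact: FsF Fh.
exists pr, (fun s => fine (D s) + eta s); split.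
- by move=> s; case: (Hpr s).
- by move=> s; case: (Hpr s).
- move=> n; under eq_bigr do rewrite mulrDr.
  rewrite big_split/= lerD2r -lee_fin.
  apply: le_trans (partial n); rewrite -sumEFin; apply: lee_sum => s _.
  by rewrite EFinM fineK.
Qed.

(** The set [Fs 0] is a singleton [{h}], and every element of [F] is within about [g] of [h]. If
    [0 \in F], then [h] itself is small and so is [f = (f - h) + h]; if [F] is symmetric, [f - h]
    and [f + h] are both small and add up to [2 f]. Without such a hypothesis a singleton class has
    [gamma = 0] and may have [d > 0]. *)
Lemma psi2_diam_le (d g : R) : F (cst 0) \/ (forall f, F f -> F (\- f)) ->
  psi2_diam mu F = d%:E -> 0 <= g -> talagrand_gamma (psi2_dist mu) F = g%:E ->
  d <= 8 * g.
Proof.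
move=> F0sym dE g0 gE; apply/ler_addgt0Pr => e e0.
have ge : (talagrand_gamma (psi2_dist mu) F < (g + e / 16)%:E)%E.
  by rewrite gE lte_fin ltrDl divr_gt0.
have [Fs aFs Fsg] := near_optimal_admissible ge.
have [FsF _ Fs1 _ _] := aFs.
have Fs_le : (Fs 0%N #<= `I_1)%card by move: Fs1; rewrite card_eq_le => /andP[].
have near f : F f -> exists h c, [/\ Fs 0%N h, orlicz_le mu c (f \- h) & c <= g + e / 8].
  move=> Ff; have [|pr [c [prF prc cG]]] := @projections Fs _ (fun=> e / 16) f aFs _ Ff (Fsg f Ff).
    by move=> _; rewrite divr_gt0.
  exists (pr 0%N), (c 0%N); split => //.
  by have := cG 1%N; rewrite !big_nat1 /w mul0r powRr0 !mul1r; lra.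
have Fs_uniq h h' : Fs 0%N h -> Fs 0%N h' -> h = h'.
  move=> hh hh'; have [e1 [_ e1h]] := card_le_enum (ex_intro _ _ hh) Fs_le.
  have [k + <-] := e1h _ hh; have [k' + <-] := e1h _ hh'.
  by rewrite !ltnS !leqn0 => /eqP -> /eqP ->.
rewrite -lee_fin -dE; apply: ge_ereal_sup => _ [f Ff <-].
have [h [c [Fh hc cg]]] := near f Ff.
have mf := mF Ff; have mh : measurable_fun setT h by apply: mF; exact: FsF Fh.
have mfh : measurable_fun setT (f \- h) by exact: measurable_funB.
have c0 : 0 < c by case: hc.
apply: (@le_trans _ _ (4 * g + e / 2)%:E); last by rewrite lee_fin; lra.
case: F0sym => [F00|Fsym].
- have [h' [c' [Fh' hc' cg']]] := near _ F00.
  move: hc'; rewrite -(Fs_uniq _ _ Fh Fh') => hc'.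
  have c'0 : 0 < c' by case: hc'.
  have mh0 : measurable_fun setT (cst 0 \- h) by exact: measurable_funB.
  have hc'' : orlicz_le mu c' h.
    by apply: (orlicz_le_trans mh mh0 c'0 _ hc') => x /=; rewrite sub0r normrN.
  have := orlicz_leD mfh mh hc hc''.
  rewrite (_ : (f \- h) \+ h = f); last by apply/funext => x /=; rewrite subrK.
  by move/psi2_orlicz/le_trans; apply; rewrite lee_fin; lra.
have [h' [c' [Fh' hc' cg']]] := near _ (Fsym _ Ff).
move: hc'; rewrite -(Fs_uniq _ _ Fh Fh') => hc'.
have c'0 : 0 < c' by case: hc'.
have mfn : measurable_fun setT (\- f) by apply: mF; exact: Fsym.
have mhn : measurable_fun setT ((\- f) \- h) by exact: measurable_funB.
have mhf : measurable_fun setT (f \+ h) by exact: measurable_funD.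
have hc'' : orlicz_le mu c' (f \+ h).
  apply: (orlicz_le_trans mhf mhn c'0 _ hc') => x /=.
  by rewrite -opprD normrN.
have o2 := orlicz_leD mfh mhf hc hc''.
have of_ : orlicz_le mu (2 * (c + c')) f.
  apply: (orlicz_le_trans mf (measurable_funD mfh mhf) _ _ o2).
    by rewrite mulr_gt0// addr_gt0.
  move=> x /=; apply: ler_wpM2r; first by rewrite invr_ge0 mulr_ge0// addr_ge0// ltW.
  have -> : f x - h x + (f x + h x) = 2 * f x by ring.
  by rewrite normrM ger0_norm// ler_peMl// ler1n.
by apply: le_trans (psi2_orlicz of_) _; rewrite lee_fin; lra.
Qed.

End Projections.

(** * Tail and expectation *)

(** Take the least admissible [s0]. The lower bound on [2^s0] yields the announced probability, the
    upper bound keeps the first link of order [gamma]; in the case [s0 = 0] that role falls to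
    [d <= 8 g]. *)
Lemma starting_level {R : realType} (x : R) : exists s0 : nat,
  x <= (2 ^ s0)%:R /\ (s0 = 0%N \/ (2 ^ s0)%:R <= 2 * x).
Proof.
have ex : exists s, x <= (2 ^ s)%:R :> R.
  exists (Num.truncn x).+1; apply/ltW/(lt_le_trans (truncnS_gt x)).
  by rewrite ler_nat ltnW// ltn_expl.
case: (ex_minnP ex) => s xs smin; exists s; split => //.
case: s xs smin => [|s] xs smin; first by left.
right; have [sx|/ltW xs'] := leP x (2 ^ s)%:R; first by have := smin s sx; rewrite ltnn.
by rewrite expnS natrM ler_wpM2l.
Qed.

Lemma geometric_sum_le {R : realType} (g : R) n : 0 <= g ->
  \sum_(0 <= s < n) g / 2 ^+ s.+1 <= g.
Proof.
move=> g0; have -> : \sum_(0 <= s < n) g / 2 ^+ s.+1 = g - g / 2 ^+ n.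
  elim: n => [|n IH]; first by rewrite big_nil expr0 divr1 subrr.
  rewrite big_nat_recr//= IH exprS.
  have h : (2 : R) ^+ n != 0 by rewrite expf_neq0.
  by field.
by rewrite gerBl divr_ge0.
Qed.

Lemma power_deviationE {R : realType} {dO dT : measure_display}
    {Omega : measurableType dO} {T : measurableType dT}
    (mu : probability Omega R) (p r d : R) (N : nat)
    (X : 'I_N -> {mfun T >-> Omega}) (phi : R -> R) (f : Omega -> R) (w : T) :
  (0 < N)%N -> power_like r phi -> measurable_fun setT f -> orlicz_le mu d f ->
  (forall x, rpower p (f x) = phi (f x)) ->
  power_deviation mu p X f w = (`|deviation mu X phi f w| / N%:R)%:E.
Proof.
move=> N0 [r1 mphi lip phi0] mf fd pE.
have fi := integrable_lipschitz r1 mphi lip phi0 mf fd.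
have fin := integrable_fin_num measurableT fi.
rewrite /power_deviation expectation.unlock.
under eq_integral do rewrite pE.
under eq_bigr do rewrite pE.
rewrite -[X in (_ - X)%E]fineK// -EFinB/= /deviation; congr EFin.
have NR : N%:R != 0 :> R by rewrite pnatr_eq0 -lt0n.
set dv := _ - _ * _.
have -> : `|dv| / N%:R = `|dv / N%:R| by rewrite normf_div [`|N%:R|]ger0_norm.
by congr Num.norm; rewrite /dv /Rintegral; field.
Qed.

(** [Bad] is chosen before [f]; only the null set may vary with [f]. *)
Lemma high_probability {R : realType} (p : R) : 2 <= p ->
  exists2 C : R, 0 < C &
  forall (dO : measure_display) (Omega : measurableType dO)
    (mu : probability Omega R)
    (dT : measure_display) (T : measurableType dT) (P : probability T R)
    (N : nat) (X : 'I_N -> {mfun T >-> Omega})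
    (F : set (Omega -> R)) (g d : R),
  (1 <= N)%N -> iid_with_law P mu X -> F !=set0 ->
  (forall f, F f -> measurable_fun setT f) ->
  (p \isn't a Num.nat -> forall f, F f -> forall x, 0 <= f x) ->
  talagrand_gamma (psi2_dist mu) F = g%:E ->
  psi2_diam mu F = d%:E -> 0 < d -> 0 < g -> d <= 8 * g ->
  forall u : R, 1 <= u ->
  exists Bad : set T, [/\ measurable Bad,
    (P Bad <= (expR (- (u ^+ 2 * (g / d) ^+ 2)))%:E)%E &
    forall f, F f -> {ae P, forall w, ~ Bad w -> (power_deviation mu p X f w <=
      (C * (u * (g * d `^ (p - 1) / Num.sqrt N%:R) + u `^ p * (g `^ p / N%:R)))%:E)%E}].
Proof.
move=> p2; have [phi plike phiE] := rpower_like p2.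
have K0 : 0 <= 24 :> R by [].
have [C C0 path] := path_bound p2 K0.
(* The total weight of a chain is [u (16 g + 5 (3 g) + g) = 32 u g], and [2^(p-1)] comes from using
   [2 d] in place of [d]. *)
pose C' := C * (32 * 2 `^ (p - 1) + 32 `^ p).
exists C'; first by rewrite mulr_gt0// addr_gt0 ?mulr_gt0 ?powR_gt0.
move=> dO Omega mu dT T P N X F g d N0 iidX F0 mF pos gE dE d0 g0 dg u u1.
have u0 : 0 <= u by lra.
(* Doubling [d], and [g] below, makes the inequalities strict, since neither infimum is known to be
   attained. *)
have Fd f : F f -> orlicz_le mu (2 * d) f.
  move=> Ff; apply: orlicz_psi2; first exact: mF.
  apply: (@le_lt_trans _ _ d%:E); last by rewrite lte_fin; lra.
  by rewrite -dE; apply: ereal_sup_ubound; exists f.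
have gg : (talagrand_gamma (psi2_dist mu) F < (2 * g)%:E)%E.
  by rewrite gE lte_fin; lra.
have [Fs aFs Fsg] := near_optimal_admissible gg.
have [FsF Fsi Fs1 Fsc _] := aFs.
have Fsn s : Fs s !=set0.
  have [f Ff] := F0.
  have [|pr [c [prF _ _]]] := @projections _ _ _ mu F mF Fs _ (fun=> 1) f aFs _ Ff (Fsg f Ff).
    by move=> _.
  by exists (pr s).
have cardFs s : (Fs s #<= `I_(2 ^ (2 ^ s)))%card.
  case: s => [|s]; last exact: Fsc.
  move: Fs1; rewrite card_eq_le => /andP[h _]; apply: (card_le_trans h).
  by rewrite card_le_II.
have mFs s f : Fs s f -> measurable_fun setT f by move=> /FsF; exact: mF.
have Fsd s f : Fs s f -> orlicz_le mu (2 * d) f by move=> /FsF; exact: Fd.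
pose w (s : nat) : R := 2 `^ (s%:R / 2).
have w0 s : 0 < w s by rewrite powR_gt0.
(* The weighted slacks [w s * eta s] form a geometric sequence with sum [g]. *)
pose eta (s : nat) := g / 2 ^+ s.+1 / w s.
have eta0 s : 0 < eta s by rewrite !divr_gt0// exprn_gt0.
have etaG n : \sum_(0 <= s < n) w s * eta s <= g.
  apply: le_trans (geometric_sum_le n (ltW g0)); apply: ler_sum => s _.
  by rewrite /eta mulrC divfK// gt_eqF.
have /choice[del Hdel] : forall sgh : nat * (Omega -> R) * (Omega -> R), exists dl : R,
    forall c, measurable_fun setT (sgh.2 \- sgh.1.2) ->
      orlicz_le mu c (sgh.2 \- sgh.1.2) ->
      orlicz_le mu dl (sgh.2 \- sgh.1.2) /\ dl <= c + eta sgh.1.1.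
  by move=> sgh; exact: near_optimal_orlicz.
pose dl s f h := del (s, f, h).
have mdiff s f h : Fs s f -> Fs s.+1 h -> measurable_fun setT (h \- f).
  by move=> Ff Fh; apply: measurable_funB; [exact: mFs Fh|exact: mFs Ff].
have Fsdel s f h : Fs s f -> Fs s.+1 h -> orlicz_le mu (dl s f h) (h \- f).
  move=> Ff Fh; have mh := mFs _ _ Fh; have mf := mFs _ _ Ff.
  have d0' : 0 < 2 * d by rewrite mulr_gt0.
  have mnf : measurable_fun setT (\- f) by exact: measurable_funN.
  have of_ : orlicz_le mu (2 * d) (\- f).
    by apply: (orlicz_le_trans mnf mf d0' _ (Fsd _ _ Ff)) => x /=; rewrite normrN.
  have := orlicz_leD mh mnf (Fsd _ _ Fh) of_.
  rewrite (_ : h \+ (\- f) = h \- f)// => o.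
  by have [] := Hdel (s, f, h) _ (mdiff _ _ _ Ff Fh) o.
have dlopt s f h c : Fs s f -> Fs s.+1 h -> orlicz_le mu c (h \- f) ->
    dl s f h <= c + eta s.
  move=> Ff Fh o.
  by have [] := Hdel (s, f, h) _ (mdiff _ _ _ Ff Fh) o.
have [s0 [s0l s0u]] := starting_level ((g / d) ^+ 2).
have [Bad [mBad PBad HBad]] := chain_good s0 N0 iidX p2 plike u1 mFs Fsd Fsn cardFs Fsdel.
exists Bad; split => //.
  apply: (le_trans PBad); rewrite lee_fin ler_expR lerN2.
  by rewrite ler_wpM2l ?sqr_ge0.
(* For [s0 > 0], minimality gives [2^s0 d^2 <= 2 g^2]; for [s0 = 0] the bound is [d <= 8 g]. *)
have start : w s0 * (2 * d) <= 16 * g.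
  have -> : w s0 = Num.sqrt (2 ^ s0)%:R.
    by rewrite natrX -powR_mulrn// -powR12_sqrt ?powR_ge0// -powRrM.
  suff : Num.sqrt (2 ^ s0)%:R * d <= 8 * g by lra.
  rewrite -[leRHS]ger0_norm; last by lra.
  rewrite -[d in leLHS]gtr0_norm// -!sqrtr_sqr -sqrtrM//.
  apply: ler_wsqrtr; case: s0u => [->|s0u].
    by rewrite expn0 mul1r lerXn2r ?nnegrE//; lra.
  apply: (@le_trans _ _ (2 * (g / d) ^+ 2 * d ^+ 2)).
    by rewrite ler_wpM2r ?sqr_ge0.
  rewrite -mulrA -exprMn divfK ?gt_eqF// exprMn.
  have := sqr_ge0 g; lra.
move=> f Ff.
have [|pr [c [prF prc cG]]] := @projections _ _ _ mu F mF Fs _ eta f aFs _ Ff (Fsg f Ff).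
  by [].
have cG' n : \sum_(0 <= s < n) w s * c s <= 3 * g.
  by apply: (le_trans (cG n)); have := etaG n; lra.
have := @deviation_ae _ _ _ _ _ mu P N X p phi u (2 * d) s0 Fs dl N0 iidX p2 plike u1
  mFs Fsd Fsn Fsdel C (16 * g) (3 * g) g _ eta (fun s => ltW (eta0 s)) etaG dlopt start
  f pr c (mF _ Ff) (Fd _ Ff) prF prc cG' Bad mBad HBad.
move=> /(_ _)[|A [mA A0 HA]].
  move=> d' U n y del' t v d'0 y0 my yd' del'0 tU hy.
  exact: (path _ _ Omega T mu N X phi d' U n y del' t v).
exists A; split => // v hv; apply: HA => hv'; apply: hv => vBad.
have phif x : rpower p (f x) = phi (f x).
  apply: phiE; have [pn|pn] := boolP (p \is a Num.nat); first by left.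
  by right; exact: pos.
rewrite (power_deviationE X v N0 plike (mF _ Ff) (Fd _ Ff) phif) lee_fin.
have N0' : 0 < N%:R :> R by rewrite ltr0n.
rewrite ler_pdivrMr//; apply: (le_trans (hv' vBad)).
have -> : u * (16 * g + 5 * (3 * g) + g) = 32 * (u * g) by ring.
rewrite !powRM ?mulr_ge0 ?(ltW g0) ?(ltW d0)//.
set a := 32 `^ p; set b := 2 `^ (p - 1); set D := d `^ _; set G := g `^ p; set V := u `^ p.
have sN : N%:R = Num.sqrt N%:R * Num.sqrt N%:R :> R by rewrite -expr2 sqr_sqrtr ?ler0n.
have sN0 : 0 < Num.sqrt N%:R :> R by rewrite sqrtr_gt0.
set s := Num.sqrt N%:R in sN sN0 *.
rewrite /C' -!mulrA ler_pM2l// mulrA.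
have -> : (32 * b + a) * ((u * (g * (D / s)) + V * (G / N%:R)) * N%:R) =
   (32 * b + a) * (u * (g * (D * s)) + V * G).
  congr (_ * _); rewrite mulrDl; congr (_ + _); last by field; rewrite gt_eqF.
  by rewrite [N%:R]sN; field; rewrite gt_eqF.
have [a0 b0] : 0 <= a /\ 0 <= b by rewrite !powR_ge0.
have [D0 G0] : 0 <= D /\ 0 <= G by rewrite !powR_ge0.
have V0 : 0 <= V by rewrite powR_ge0.
rewrite -subr_ge0.
rewrite [leRHS](_ : _ = 32 * b * (V * G) + a * (u * (g * (D * s)))); last by ring.
by apply: addr_ge0; repeat (apply: mulr_ge0 => //); exact: ltW.
Qed.

(** * Integration of the tail *)

Section Moment.
Context {R : realType} {dT : measure_display} {T : measurableType dT}.
Variable P : probability T R.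

(** The 64 is the square of the 8 in [d <= 8 g]. With [x = k+1] the exponents add up to
    [2 x + 1 - x^2/64], and completing the square bounds this by 65. *)
Lemma subgaussian_series_le (p : R) (k : nat) : 0 < p ->
  k.+2%:R `^ p * expR (- (k.+1%:R ^+ 2 / 64)) <=
    (p `^ p * expR 66) / (2 ^ k.+1)%:R.
Proof.
move=> p0; rewrite ler_pdivlMr ?ltr0n ?expn_gt0//.
have h1 := powR_le_expR ltr01 p0 (ler0n R k.+2).
rewrite divr1 mul1r in h1.
have h2 : (2 ^ k.+1)%:R <= expR k.+1%:R :> R by exact: natr_exp2_le.
apply: (@le_trans _ _ (p `^ p * expR k.+2%:R * expR (- (k.+1%:R ^+ 2 / 64)) *
    expR k.+1%:R)).
  apply: ler_pM; rewrite ?mulr_ge0 ?powR_ge0 ?expR_ge0//.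
  by rewrite ler_wpM2r ?expR_ge0.
rewrite -!mulrA ler_wpM2l ?powR_ge0// -!expRD ler_expR.
rewrite -[k.+2%:R]natr1; set x : R := k.+1%:R.
have := sqr_ge0 (x - 64); lra.
Qed.

(* Z <= M + sum_k M (k+2)^p 1_{Z > M (k+1)^p}. *)
Lemma integral_le_of_tail (p M : R) (Z : T -> \bar R) : 1 <= p -> 0 < M ->
  measurable_fun setT Z ->
  (forall k, (P [set w | (M * k.+1%:R `^ p)%:E < Z w] <=
    (expR (- (k.+1%:R ^+ 2 / 64)))%:E)%E) ->
  (\int[P]_w Z w <= (M * (1 + p `^ p * expR 66))%:E)%E.
Proof.
move=> p1 M0 mZ tail; have p0 : 0 < p := lt_le_trans ltr01 p1.
pose A k := [set w | ((M * k.+1%:R `^ p)%:E < Z w)%E].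
have mA k : measurable (A k).
  by rewrite -[X in measurable X]setTI; apply: measurable_lte.
pose term k (w : T) : \bar R := (M * k.+2%:R `^ p * \1_(A k) w)%:E.
have term0 k w : (0 <= term k w)%E.
  rewrite lee_fin; apply: mulr_ge0; last by rewrite indicE.
  by rewrite mulr_ge0 ?powR_ge0// ltW.
have mterm k : measurable_fun setT (term k).
  by apply/measurable_EFinP; apply: measurable_funM => //; exact: measurable_indic.
pose h w : \bar R := (M%:E + \sum_(0 <= k <oo) term k w)%E.
have partial n w : (M%:E + \sum_(0 <= k < n) term k w <= h w)%E.
  by rewrite leeD2l//; apply: nneseries_lim_ge.
have step n w : (Z w <= (M * n.+1%:R `^ p)%:E)%E ->
    (Z w <= M%:E + \sum_(0 <= k < n) term k w)%E.
  elim: n => [|n IH]; first by rewrite powR1 mulr1 big_nil adde0.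
  have [Zn _|Zn Zn1] := leP (Z w) (M * n.+1%:R `^ p)%:E.
    apply: (le_trans (IH Zn)); rewrite leeD2l// big_nat_recr//=.
    by rewrite leeDl.
  apply: (le_trans Zn1); rewrite big_nat_recr//= /term indicE mem_set// mulr1.
  rewrite addeA; apply: leeDr; apply: adde_ge0; first by rewrite lee_fin ltW.
  by apply: sume_ge0 => i _; exact: term0.
have Zh w : (Z w <= h w)%E.
  have [Zy|Zy] := eqVneq (Z w) +oo%E; last first.
    have [n Zn] : exists n : nat, (Z w <= (M * n.+1%:R `^ p)%:E)%E.
      case: (Z w) Zy => [r _|//|_]; last by exists 0%N; exact: leNye.
      exists (Num.truncn (r / M)); rewrite lee_fin mulrC -ler_pdivrMr//.
      apply/ltW/(lt_le_trans (truncnS_gt _)).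
      by apply: le1r_powR; rewrite ?ler1n.
    exact: le_trans (step n w Zn) (partial n w).
  (* Where [Z] is infinite every term of the series is at least [M], so [h] exceeds every real
     [r]. *)
  rewrite Zy leye_eq; apply/eqP/eqyP => r r0.
  have wA k : A k w by rewrite /A /= Zy ltry.
  have Mterm k : (M%:E <= term k w)%E.
    rewrite lee_fin indicE mem_set// mulr1 ler_peMr ?(ltW M0)//.
    apply: (@le_trans _ _ k.+2%:R); first by rewrite ler1n.
    by apply: le1r_powR => //; rewrite ler1n.
  have H n : ((n%:R * M)%:E <= \sum_(0 <= k < n) term k w)%E.
    elim: n => [|n IH]; first by rewrite mul0r big_nil.
    by rewrite big_nat_recr//= -natr1 mulrDl mul1r EFinD; exact: leeD.
  apply: le_trans (partial (Num.truncn (r / M)).+1 w).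
  rewrite -[leLHS]add0e; apply: leeD; first by rewrite lee_fin ltW.
  apply: le_trans (H _); rewrite lee_fin -ler_pdivrMr//.
  exact/ltW/truncnS_gt.
have h0 w : (0 <= h w)%E.
  by rewrite adde_ge0 ?lee_fin ?(ltW M0)// nneseries_ge0.
have mh : measurable_fun setT h.
  apply: emeasurable_funD => //; exact: ge0_emeasurable_sum.
apply: (@le_trans _ _ (\int[P]_w h w)%E).
  rewrite integralE; apply: (@le_trans _ _ (\int[P]_w (Z^\+ w))%E).
    rewrite -[leRHS]adde0; apply: leeD => //.
    by rewrite oppe_le0; exact: integral_ge0.
  apply: ge0_le_integral => //.
  - exact: measurable_funepos.
  - by move=> w _; rewrite funeposE ge_max Zh h0.
rewrite /h ge0_integralD//; last 3 first.
- by move=> w _; rewrite lee_fin ltW.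
- by move=> w _; exact: nneseries_ge0.
- exact: ge0_emeasurable_sum.
rewrite integral_nneseries// integral_probability_cst mulrDr mulr1 EFinD leeD2l//.
pose C := M * (p `^ p * expR 66).
apply: (@le_trans _ _ (\sum_(0 <= k <oo) (0 + (C / (2 ^ k.+1)%:R)%:E))%E).
  apply: lee_nneseries => [k _ _|k _]; first exact: integral_ge0.
  rewrite add0e /term; under eq_integral do rewrite EFinM.
  rewrite ge0_integralZl_EFin//; last 2 first.
  - by apply/measurable_EFinP; exact: measurable_indic.
  - by rewrite mulr_ge0 ?powR_ge0 ?(ltW M0).
  rewrite integral_indic// setIT.
  apply: (le_trans (lee_wpmul2l _ (tail k))); first by rewrite lee_fin mulr_ge0 ?powR_ge0 ?(ltW M0).
  rewrite -EFinM lee_fin /C -[leLHS]mulrA -[leRHS]mulrA ler_pM2l//.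
  exact: subgaussian_series_le.
apply: (le_trans (epsilon_trick (A := fun=> 0%E) xpredT _ _)) => //.
  by rewrite !mulr_ge0 ?powR_ge0 ?expR_ge0 ?(ltW M0).
by rewrite eseries0// add0e.
Qed.

End Moment.

Theorem theorem2p2 (R : realType) (p : R) (hp : 2 <= p) :
  exists C : R, 0 < C /\
  forall (dO : measure_display) (Omega : measurableType dO)
    (mu : probability Omega R)
    (dT : measure_display) (T : measurableType dT) (P : probability T R)
    (N : nat) (X : 'I_N -> {mfun T >-> Omega})
    (F : set (Omega -> R)),
  let gammaF := talagrand_gamma (psi2_dist mu) F in
  let dF := psi2_diam mu F in
  let g := fine gammaF in
  let d := fine dF in
  (1 <= N)%N ->
  iid_with_law P mu X ->
  F !=set0 ->
  (forall f, F f -> measurable_fun setT f) ->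
  (p \isn't a Num.nat -> forall f, F f -> forall x, 0 <= f x) ->
  (gammaF < +oo)%E ->
  (0 < dF)%E -> (dF < +oo)%E ->
  F (cst 0) \/ (forall f, F f -> F (\- f)) ->
  forall Z : T -> \bar R,
  is_lattice_sup P F (power_deviation mu p X) Z ->
  (forall u : R, 1 <= u ->
    ((1 - expR (- (u ^+ 2 * (g / d) ^+ 2)))%:E <=
     P [set w | Z w <= (C * (u * (g * d `^ (p - 1) / Num.sqrt N%:R)
                             + u `^ p * (g `^ p / N%:R)))%:E])%E) /\
  (\int[P]_w Z w <=
     (C * (g * d `^ (p - 1) / Num.sqrt N%:R + g `^ p / N%:R))%:E)%E.
Proof.
have [C C0 hprob] := high_probability hp.
have p1 : 1 <= p by lra.
have p0 : 0 < p := lt_le_trans ltr01 p1.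
(* The loss in integrating the tail; as [L >= 1], the constant [C L] serves both conclusions. *)
pose L := 1 + p `^ p * expR 66.
have L1 : 1 <= L by rewrite lerDl mulr_ge0 ?powR_ge0 ?expR_ge0.
have L0 : 0 < L := lt_le_trans ltr01 L1.
exists (C * L); split; first exact: mulr_gt0.
move=> dO Omega mu dT T P N X F gammaF dF g d N1 iidX F0 mF pos gammay dF0 dFy F0sym Z Zsup.
have gE : talagrand_gamma (psi2_dist mu) F = g%:E.
  by rewrite /g fineK// ge0_fin_numE// talagrand_gamma_ge0.
have dE : psi2_diam mu F = d%:E.
  by rewrite /d fineK// ge0_fin_numE// ltW.
have d0 : 0 < d by rewrite -lte_fin -dE.
have g_ge0 : 0 <= g by rewrite -lee_fin -gE talagrand_gamma_ge0.
have dg : d <= 8 * g by exact: (psi2_diam_le mF F0sym dE g_ge0 gE).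
have g0 : 0 < g by lra.
have {}hprob := hprob _ _ mu _ _ P N X F g d N1 iidX F0 mF pos gE dE d0 g0 dg.
have [[mZ _] Zmin] := Zsup.
set a := g * d `^ (p - 1) / Num.sqrt N%:R in hprob *.
set b := g `^ p / N%:R in hprob *.
have a0 : 0 <= a by rewrite divr_ge0 ?mulr_ge0 ?powR_ge0 ?sqrtr_ge0.
have b0 : 0 < b by rewrite divr_gt0 ?powR_gt0// ltr0n.
have mZle c : measurable [set w | (Z w <= c%:E)%E].
  by rewrite -[X in measurable X]setTI; apply: measurable_lee.
have tail u : 1 <= u -> (P (~` [set w | (Z w <= (C * (u * a + u `^ p * b))%:E)%E]) <=
    (expR (- (u ^+ 2 * (g / d) ^+ 2)))%:E)%E.
  move=> u1; have [Bad [mBad PBad HBad]] := hprob u u1.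
  set c := C * _.
  (* Infinite on [Bad] and constant elsewhere, [W] is measurable and dominates each deviation almost
     surely. Minimality of [Z] gives [Z <= W] almost surely, so [Z > c] only on [Bad] and a null
     set. *)
  pose W w : \bar R := if w \in Bad then +oo%E else c%:E.
  have mW : measurable_fun setT W.
    apply: measurable_fun_ifT => //.
    apply: (measurable_fun_bool true) => //.
    by rewrite setTI (_ : _ @^-1` _ = Bad)//; apply/seteqP; split => x /=; [exact: set_mem|exact: mem_set].
  have [|A [mA A0 HA]] := Zmin W.
    split => // f Ff; have [A [mA A0 HA]] := HBad f Ff.
    exists A; split => // w hw; apply: HA => hw'; apply: hw; rewrite /W /=.
    by case: (boolP (w \in Bad)) => [_|]; [exact: leey|rewrite notin_setE => /hw'].
  apply: (@le_trans _ _ (P (Bad `|` A))).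
    apply: le_measure; rewrite ?inE; [exact: measurableC|exact: measurableU|].
    move=> w /= Zw; have [wBad|wBad] := pselect (Bad w); first by left.
    by right; apply: HA => /=; rewrite /W memNset.
  by apply: (le_trans (measureU2 _ mBad mA)); rewrite [X in (_ + X <= _)%E]A0 adde0.
split.
  move=> u u1; set c := C * L * _.
  have : (1%E - (expR (- (u ^+ 2 * (g / d) ^+ 2)))%:E <= 
     1%E - P (~` [set w | (Z w <= (C * (u * a + u `^ p * b))%:E)%E]))%E.
    by rewrite leeB// tail.
  rewrite -probability_setC; last exact: measurableC.
  rewrite setCK EFinB => /le_trans; apply.
  apply: le_measure; rewrite ?inE// => w /= /le_trans; apply; rewrite lee_fin.
  rewrite /c -mulrA ler_pM2l// ler_peMl// addr_ge0 ?mulr_ge0 ?powR_ge0 ?(ltW b0)//.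
  exact: le_trans u1.
rewrite -mulrA [L * _]mulrC mulrA.
(* Here [M = C (a + b)]. At [u = k + 1 >= 1] one has [u <= u^p], so [C (u a + u^p b) <= M u^p] and
   the tail bound at [u] controls the event that [Z] exceeds [M u^p]. *)
apply: integral_le_of_tail => //; first by rewrite mulr_gt0// ltr_wpDl.
move=> k; have k1 : 1 <= k.+1%:R :> R by rewrite ler1n.
apply: (@le_trans _ _ (expR (- (k.+1%:R ^+ 2 * (g / d) ^+ 2)))%:E); last first.
  rewrite lee_fin ler_expR lerN2 ler_wpM2l ?sqr_ge0//.
  have : 8^-1 <= g / d by rewrite ler_pdivlMr// mulrC ler_pdivrMr// mulrC.
  have : 0 < g / d by exact: divr_gt0.
  nra.
apply: le_trans (tail _ k1); apply: le_measure; rewrite ?inE.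
- by rewrite -[X in measurable X]setTI; apply: measurable_lte.
- exact: measurableC.
move=> w /= Zw; apply/negP; rewrite -ltNge; apply: le_lt_trans Zw.
rewrite lee_fin -mulrA ler_pM2l// mulrDl [b * _]mulrC lerD2r.
by rewrite mulrC ler_wpM2l// le1r_powR.
Qed.
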